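(* Let $d\ge2$ and let $T$ be a band-limited random field on $\mathbb{S}^d$ with bandwidth $L_0\in\mathbb{N}$, i.e. $T(x)=\sum_{\ell=0}^{L_0}\sum_{\mathbf{m}\in\mathcal{M}_\ell}a_{\ell,\mathbf{m}}Y_{\ell,\mathbf{m}}(x)$, $x\in\mathbb{S}^d$ (so $a_{\ell,\mathbf{m}}=0$ for $\ell>L_0$). Suppose $T$ is sampled by the spherical uniform sampling scheme with $Q=Q_0=\dots=Q_{d-2}>L_0$, $Q_{d-1}=2M$ and $M>L_0$. Then $$\tilde a_{\ell,\mathbf{m}}=a_{\ell,\mathbf{m}}\qquad\text{for }\ell\le L_0,\ \mathbf{m}\in\mathcal{M}_\ell.$$ Furthermore, for any $L\in\mathbb{N}$ with $Q\ge L\ge L_0$, the following reconstruction holds exactly for $x\in\mathbb{S}^d$: $$T(x)=\sum_{k_0=0}^{Q_0-1}\cdots\sum_{k_{d-1}=0}^{Q_{d-1}-1}\left(\prod_{j=0}^{d-1}w^{(j+1)}_{k_j}\right)\left(\prod_{j=1}^{d-1}\left(\sin\vartheta^{(j)}_{k_{j-1}}\right)^{d-j}\right)T(x_{\mathbf{k}})\sum_{\ell=0}^{L}K_\ell(x,x_{\mathbf{k}}),$$ where $x_{\mathbf{k}}=(\vartheta^{(1)}_{k_0},\dots,\vartheta^{(d-1)}_{k_{d-2}},\varphi_{k_{d-1}})$.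
   Context: **Harmonics.** Points of $\mathbb{S}^d$ are written $x=(\boldsymbol\vartheta,\varphi)=(\vartheta^{(1)},\dots,\vartheta^{(d-1)},\varphi)$, $\vartheta^{(i)}\in[0,\pi]$, $\varphi\in[0,2\pi)$; $f(\boldsymbol\vartheta)=\prod_{j=1}^{d-1}(\sin\vartheta^{(j)})^{d-j}$ and $dx=f(\boldsymbol\vartheta)\,d\vartheta^{(1)}\cdots d\vartheta^{(d-1)}d\varphi$. For $\ell\ge0$, $\mathcal{M}_\ell$ is the set of $\mathbf{m}=(m_1,\dots,m_{d-1})\in\mathbb{Z}^{d-1}$ with $\ell\ge m_1\ge\dots\ge m_{d-2}\ge0$, $-m_{d-2}\le m_{d-1}\le m_{d-2}$; convention $m_0=\ell$. $C_n^{(\alpha)}$ is the Gegenbauer polynomial (generating function $(1-2tz+z^2)^{-\alpha}=\sum_nC_n^{(\alpha)}(t)z^n$). The orthonormal hyperspherical harmonics are $$Y_{\ell,\mathbf{m}}(x)=\frac1{\sqrt{2\pi}}\prod_{j=1}^{d-1}\left(h_{m_{j-1},m_j;j}C^{(m_j+\frac{d-j}2)}_{m_{j-1}-m_j}(\cos\vartheta^{(j)})(\sin\vartheta^{(j)})^{m_j}\right)e^{im_{d-1}\varphi},$$ $$h_{m_{j-1},m_j;j}=\left(\frac{2^{2m_j+d-j-2}(m_{j-1}-m_j)!(2m_{j-1}+d-j)\Gamma^2(m_j+\frac{d-j}2)}{\pi(m_{j-1}+m_j+d-j-1)!}\right)^{1/2}.$$ $K_\ell(x,x')=\sum_{\mathbf{m}\in\mathcal{M}_\ell}Y_{\ell,\mathbf{m}}(x)\overline{Y_{\ell,\mathbf{m}}(x')}$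 is the kernel of the orthogonal projector onto the span of $\{Y_{\ell,\mathbf{m}}:\mathbf{m}\in\mathcal{M}_\ell\}$. The random harmonic coefficients are $a_{\ell,\mathbf{m}}=\int_{\mathbb{S}^d}T\,\overline{Y_{\ell,\mathbf{m}}}\,dx$. **Spherical uniform sampling.** $Q_0,\dots,Q_{d-2},M\in\mathbb{N}$, $Q_{d-1}=2M$. Azimuth: $\varphi_{k}=k\pi/M$ with weight $w^{(d)}_{k}=\pi/M$, $k=0,\dots,2M-1$. For $j=1,\dots,d-1$: $t^{(j)}_0<\dots<t^{(j)}_{Q_{j-1}-1}$ are the zeros of $C^{(\frac{d-j}{2})}_{Q_{j-1}}$, $\omega_k^{(j)}=\int_{-1}^1(1-t^2)^{\frac{d-j-1}{2}}\prod_{i\ne k}\frac{t-t^{(j)}_i}{t^{(j)}_k-t^{(j)}_i}\,dt$ are the corresponding Gauss–Gegenbauer weights, and $\vartheta^{(j)}_k=\arccos t^{(j)}_k$, $w^{(j)}_k=\omega^{(j)}_k/(\sin\vartheta^{(j)}_k)^{d-j}$. The sampling points are all $(\vartheta^{(1)}_{k_0},\dots,\vartheta^{(d-1)}_{k_{d-2}},\varphi_{k_{d-1}})$, $0\le k_{j-1}\le Q_{j-1}-1$, with weights $\prod_{j=1}^dw^{(j)}_{k_{j-1}}$; enumerate them as $x_i=(\boldsymbol\vartheta_i,\varphi_i)$, $w_i$, $i=1,\dots,N$. The aliased coefficient is $\tilde a_{\ell,\mathbf{m}}=\sum_{i=1}^Nw_iT(x_i)\overline{Y_{\ell,\mathb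f{m}}(x_i)}f(\boldsymbol\vartheta_i)$.
   Formalization: The reconstruction formula is proved under the additional condition L + L_0 < 2M; without it the claim fails (e.g. d=2, L_0=0, M=1, Q=L=2, T a nonzero constant), because degrees between L_0 and L pick up azimuthal aliases. *)

(* Defs.v *)
From HB Require Import structures.
From mathcomp Require Import all_boot all_order all_algebra.
From mathcomp Require Import all_classical all_reals all_analysis.
From mathcomp Require Export complex.
Export numFieldNormedType.Exports.

Set Implicit Arguments.
Unset Strict Implicit.
Unset Printing Implicit Defensive.

Import Order.TTheory GRing.Theory Num.Theory.
Local Open Scope classical_set_scope.
Local Open Scope ring_scope.

Definition gamma_int (R : realType) (x : R) : R :=
  (\int[@lebesgue_measure R]_(t in `]0%R, +oo[) (t `^ (x - 1) * expR (- t)))%R.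

(* Euler's integral for 0 < x, continued to the other non-poles through
   Gamma(x + n) = x (x + 1) ... (x + n - 1) Gamma(x), for an n with 0 < x + n.
   Negative half-integers do occur as arguments below (when m_{d-1} < 0). *)
Definition gamma (R : realType) (x : R) : R :=
  let n := if 0 < x then 0%N else (Num.truncn (- x)).+1 in
  gamma_int (x + n%:R) / \prod_(i < n) (x + i%:R).

Definition gbinom (R : fieldType) (a : R) (k : nat) : R :=
  (\prod_(i < k) (a - i%:R)) / k`!%:R.

(* C_n^(alpha) is the coefficient of z^n in the generating function
   (1 - 2 t z + z^2)^(-alpha) = \sum_k gbinom (- alpha) k (z^2 - 2 t z)^k.
   Polynomials in z over polynomials in t: the outer 'X is z, the inner one
   is t. The terms with n < k are multiples of z^(n+1) and do not contribute. *)
Definition gegenbauer (R : fieldType) (alpha : R) (n : nat) : {poly R} :=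
  (\sum_(k < n.+1)
     (gbinom (- alpha) k)%:P%:P * ('X^2 - (2%:R *: 'X)%:P * 'X) ^+ k
     : {poly {poly R}})`_n.

(* ((theta^(1), ..., theta^(d-1)), phi) *)
Definition spoint (R : realType) (d : nat) : Type := ((d.-1).-tuple R * R)%type.

(* theta^(j), 1 <= j <= d-1 *)
Definition colat (R : realType) (d : nat) (v : (d.-1).-tuple R) (j : nat) : R :=
  nth 0 v j.-1.

Definition sphere_coords (R : realType) (d : nat) : set (spoint R d) :=
  [set x | (forall j, (1 <= j < d)%N -> 0 <= colat x.1 j <= pi)
           /\ 0 <= x.2 < 2 * pi].
Arguments sphere_coords : clear implicits.

Definition jacobian (R : realType) (d : nat) (v : (d.-1).-tuple R) : R :=
  \prod_(1 <= j < d) sin (colat v j) ^+ (d - j).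

Fixpoint colat_integral (R : realType) (n : nat) :
    (n.-tuple R -> R) -> R :=
  match n return (n.-tuple R -> R) -> R with
  | 0 => fun F => F [tuple]
  | n'.+1 => fun F =>
      (\int[@lebesgue_measure R]_(t in `[0%R, pi])
         colat_integral (fun v : n'.-tuple R => F [tuple of t :: v]))%R
  end.

Definition sphere_Rintegral (R : realType) (d : nat) (F : spoint R d -> R) : R :=
  colat_integral (fun v : (d.-1).-tuple R =>
    (\int[@lebesgue_measure R]_(p in `[0%R, (2 * pi)%R[)
       (F (v, p) * jacobian v))%R).

Definition sphere_integral (R : realType) (d : nat)
    (F : spoint R d -> R[i]) : R[i] :=
  Complex (sphere_Rintegral (fun x => complex.Re (F x)))
          (sphere_Rintegral (fun x => complex.Im (F x))).

(* m_j for 0 <= j <= d-1, with the convention m_0 = l *)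
Definition mcoord (d l : nat) (m : (d.-1).-tuple int) (j : nat) : int :=
  nth 0 (l%:Z :: m) j.

Definition harm_index (d l : nat) : set ((d.-1).-tuple int) :=
  [set m | [/\ forall j, (1 <= j < d.-1)%N -> mcoord l m j <= mcoord l m j.-1,
               0 <= mcoord l m d.-2
             & - mcoord l m d.-2 <= mcoord l m d.-1 <= mcoord l m d.-2]].
Arguments harm_index : clear implicits.

(* h_{a,b;j}. On the indices of harm_index the integers a - b and a + b + d - j - 1
   are nonnegative, so that the absolute values only turn them into nats. *)
Definition hnorm (R : realType) (d : nat) (a b : int) (j : nat) : R :=
  Num.sqrt
    (2%:R ^ (2 * b + (d - j)%:Z - 2)
     * `|(a - b)%R|%N`!%:R
     * (2 * a + (d - j)%:Z)%:~R
     * gamma (b%:~R + (d - j)%:R / 2) ^+ 2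
     / (pi * `|(a + b + (d - j)%:Z - 1)%R|%N`!%:R)).

Definition expi (R : realType) (t : R) : R[i] := Complex (cos t) (sin t).

(* The exponent m_{d-1} of sin theta^(d-1) may be negative; at a pole, where
   sin theta^(d-1) = 0, the convention 0^-1 = 0 gives the factor 0, which is
   the value there of the continuous extension of the harmonic. *)
Definition hharm (R : realType) (d l : nat) (m : (d.-1).-tuple int)
    (x : spoint R d) : R[i] :=
  ((Num.sqrt (2 * pi))^-1 *
   \prod_(1 <= j < d)
     (let a := mcoord l m j.-1 in
      let b := mcoord l m j in
      hnorm R d a b j
      * (gegenbauer (b%:~R + (d - j)%:R / 2) `|(a - b)%R|%N).[cos (colat x.1 j)]
      * sin (colat x.1 j) ^ b))%:C%C
  * expi ((mcoord l m d.-1)%:~R * x.2).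

Definition proj_kernel (R : realType) (d l : nat) (x y : spoint R d) : R[i] :=
  \sum_(m \in harm_index d l) hharm l m x * ((hharm l m y)^*)%C.

Definition harm_coef (R : realType) (d : nat) (f : spoint R d -> R[i])
    (l : nat) (m : (d.-1).-tuple int) : R[i] :=
  sphere_integral (fun x => f x * ((hharm l m x)^*)%C).

Definition random_field (R : realType) (d : nat) (disp : measure_display)
    (Om : measurableType disp) (T : spoint R d -> Om -> R[i]) : Prop :=
  forall x, sphere_coords R d x ->
    measurable_fun setT (fun w => complex.Re (T x w)) /\
    measurable_fun setT (fun w => complex.Im (T x w)).

Definition band_limited (R : realType) (d : nat) (disp : measure_display)
    (Om : measurableType disp) (T : spoint R d -> Om -> R[i]) (L0 : nat) : Prop :=
  forall w x, sphere_coords R d x ->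
    T x w = \sum_(l < L0.+1) \sum_(m \in harm_index d l)
              harm_coef (T^~ w) l m * hharm l m x.

(* The sampling scheme has Q_0 = ... = Q_{d-2} = Q and Q_{d-1} = 2 M:
   t j enumerates increasingly the zeros of C_Q^((d-j)/2), 1 <= j <= d-1. *)
Definition gegenbauer_nodes (R : realType) (d Q : nat)
    (t : nat -> 'I_Q -> R) : Prop :=
  forall j, (1 <= j < d)%N ->
    (forall k k' : 'I_Q, (k < k')%N -> t j k < t j k') /\
    (forall z, root (gegenbauer ((d - j)%:R / 2 : R) Q) z <-> exists k, z = t j k).

Section Sampling.
Variables (R : realType) (d Q M : nat) (t : nat -> 'I_Q -> R).

Definition gauss_weight (j : nat) (k : 'I_Q) : R :=
  (\int[@lebesgue_measure R]_(s in `[(-1)%R, 1%R])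
     ((1 - s ^+ 2) `^ ((d - j - 1)%:R / 2) *
      \prod_(i < Q | i != k) ((s - t j i) / (t j k - t j i))))%R.

Definition node_colat (j : nat) (k : 'I_Q) : R := acos (t j k).

(* w^(j)_k for 1 <= j <= d-1 *)
Definition colat_weight (j : nat) (k : 'I_Q) : R :=
  gauss_weight j k / sin (node_colat j k) ^+ (d - j).

(* w^(d)_k, for every k *)
Definition azimuth_weight : R := pi / M%:R.

(* A multi-index (k_0, ..., k_{d-1}) is a pair of (k_0, ..., k_{d-2}), whose
   i-th entry belongs to theta^(i+1), and k_{d-1}. *)
Definition sample_point (k : {ffun 'I_d.-1 -> 'I_Q}) (p : 'I_(2 * M)) :
    spoint R d :=
  ([tuple node_colat i.+1 (k i) | i < d.-1], p%:R * pi / M%:R).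

Definition sample_weight (k : {ffun 'I_d.-1 -> 'I_Q}) : R :=
  (\prod_(i < d.-1) colat_weight i.+1 (k i)) * azimuth_weight.

Definition aliased_coef (f : spoint R d -> R[i]) (l : nat)
    (m : (d.-1).-tuple int) : R[i] :=
  \sum_(k : {ffun 'I_d.-1 -> 'I_Q}) \sum_(p < 2 * M)
    (sample_weight k)%:C%C * f (sample_point k p)
    * ((hharm l m (sample_point k p))^*)%C
    * (jacobian (sample_point k p).1)%:C%C.

End Sampling.

(* Main.v *)
(** The sampling rule integrates products of harmonics exactly, so the harmonics
    of low degree are orthonormal for the discrete scalar product of the scheme;
    both claims follow by expanding [T] and exchanging finite sums, and the
    continuous integral over the sphere is never computed.

    The azimuthal sum is a sum of roots of unity and forces m_{d-1} = m'_{d-1}.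
    The remaining sum factors over the colatitudes. If (m_0, ..., m_{d-1}) and
    (m'_0, ..., m'_{d-1}) differ, take the last i with m_i <> m'_i: in the factor
    of theta^(i+1) the two Gegenbauer polynomials have the same parameter, and
    their product times (1 - t^2)^{m_{i+1}} has degree m_i + m'_i < 2 Q, so that
    Gauss quadrature turns the sum into an orthogonality integral.

    Orthogonality and norms of the Gegenbauer polynomials for the weight
    (1 - s^2)^(alpha - 1/2), 2 alpha a positive integer, come from the differential
    equation, integration by parts and C_n^(alpha)' = 2 alpha C_(n-1)^(alpha+1).
    For m_{d-1} < 0 the half-integer parameter is negative, and the factor is
    identified with the one for |m_{d-1}| because C_(a+m)^(1/2-m) and
    (1 - t^2)^m C_(a-m)^(1/2+m) solve the same differential equation. *)
Require Import Defs.
From HB Require Import structures.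
From mathcomp Require Import all_boot all_order all_algebra.
From mathcomp Require Import ring lra zify finmap.
From mathcomp Require Import all_classical all_reals all_analysis measurable_realfun.
Import Order.TTheory GRing.Theory Num.Theory.
Local Open Scope classical_set_scope.
Local Open Scope ring_scope.
Set Implicit Arguments.
Unset Strict Implicit.
Unset Printing Implicit Defensive.

(** * Gegenbauer polynomials *)

Section GegenbauerAlgebra.
Variable R : realFieldType.
Implicit Types (alpha x : R) (p q : {poly R}).

(** The Pochhammer symbol; being polynomial in [alpha], it serves positive and negative parameters
    alike. *)
Definition rising alpha (k : nat) : R := \prod_(i < k) (alpha + i%:R).

Lemma risingSr alpha k : rising alpha k.+1 = rising alpha k * (alpha + k%:R).
Proof. by rewrite /rising big_ord_recr. Qed.

Lemma risingSl alpha k : rising alpha k.+1 = alpha * rising (alpha + 1) k.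
Proof.
rewrite /rising big_ord_recl addr0; congr (_ * _).
by apply: eq_bigr => i _; rewrite lift0 -addrA nat1r.
Qed.

Lemma risingD alpha k l :
  rising alpha (k + l) = rising alpha k * rising (alpha + k%:R) l.
Proof.
elim: l => [|l IH]; first by rewrite addn0 /rising big_ord0 mulr1.
by rewrite addnS !risingSr IH natrD; ring.
Qed.

Lemma rising_gt0 alpha k : 0 < alpha -> 0 < rising alpha k.
Proof. by move=> a0; apply: prodr_gt0 => i _; rewrite ltr_wpDr. Qed.

Lemma gbinomN alpha k : gbinom (- alpha) k = (-1) ^+ k * rising alpha k / k`!%:R.
Proof.
rewrite /gbinom /rising; congr (_ / _).
elim: k => [|k IH]; first by rewrite !big_ord0 expr0 mul1r.
by rewrite !big_ord_recr /= IH exprS; ring.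
Qed.

(** Up to its [gbinom] factor, the term of index k = n - j of the generating series is z^k (z - 2
    t)^k, whose coefficient at z^n is that of (z - 2 t)^k at z^j. *)
Lemma gegenbauerE alpha n : gegenbauer alpha n =
  \sum_(j < n.+1) (gbinom (- alpha) (n - j) * (-2) ^+ (n - j - j)
                     *+ 'C(n - j, j)) *: 'X^(n - j - j).
Proof.
rewrite /gegenbauer coef_sum (reindex_inj rev_ord_inj) /=.
apply: eq_bigr => j _; rewrite coefCM subSS.
have jn : (j <= n)%N by rewrite -ltnS.
set k := (n - j)%N.
have -> : 'X^2 - (2%:R *: 'X)%:P * 'X
  = ('X + (- (2%:R *: 'X : {poly R}))%:P) * 'X :> {poly {poly R}}.
  by rewrite mulrDl polyCN mulNr expr2.
rewrite exprMn_comm; last exact: commr_polyX.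
rewrite coefMXn; have -> : (n < k)%N = false by rewrite /k; lia.
have -> : (n - k)%N = j by rewrite /k; lia.
rewrite exprDn coef_sum.
(* For j > k the truncated exponent n - j - j is 0, and the term vanishes through its binomial
   coefficient. *)
have [jk|kj] := leqP j k; last first.
  rewrite bin_small// mulr0n scale0r big1 ?mulr0// => i _.
  rewrite coefMn -rmorphXn/= coefMC coefXn.
  case: eqP => [ji|_]; last by rewrite mul0r mul0rn.
  by move: kj; rewrite ji; lia.
have kjk : (k - j < k.+1)%N by lia.
rewrite (bigD1 (Ordinal kjk)) //= big1 ?addr0 => [|i /eqP/val_eqP/= ij].
  rewrite coefMn -rmorphXn/= coefMC coefXn.
  have -> : (k - (k - j))%N = j by lia.
  rewrite eqxx mul1r bin_sub//.

  by rewrite -scaleNr exprZn mulrnAr mul_polyC scalerA scalerMnl.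
rewrite coefMn -rmorphXn/= coefMC coefXn.
case: eqP => [ki|_]; last by rewrite mul0r mul0rn.
by move: i (ltn_ord i) ij ki jk => [i /= ?]; lia.
Qed.

(* The coefficient of t^i in C_(i+2j)^(alpha). *)
Definition gegenbauer_coef alpha (i j : nat) : R :=
  (-1) ^+ j * rising alpha (i + j) * 2 ^+ i / (j`!%:R * i`!%:R).

Lemma fact_neq0 n : n`!%:R != 0 :> R.
Proof. by rewrite pnatr_eq0 -lt0n fact_gt0. Qed.

Lemma coef_gegenbauer alpha i j :
  (gegenbauer alpha (i + j.*2))`_i = gegenbauer_coef alpha i j.
Proof.
rewrite gegenbauerE coef_sum.
have jn : (j < (i + j.*2).+1)%N by lia.
rewrite (bigD1 (Ordinal jn))//= big1 ?addr0 => [|k /eqP/val_eqP/= kj]; last first.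
  rewrite coefZ coefXn; case: eqP => [ik|_]; last by rewrite mulr0.
  by rewrite bin_small ?mulr0n ?mul0r//; lia.
have -> : (i + j.*2 - j)%N = (i + j)%N by lia.
rewrite addnK coefZ coefXn eqxx mulr1 gbinomN -mulr_natr.
(* The factorial in [gbinom] cancels against the binomial coefficient. *)
have := bin_fact (leq_addl i j); rewrite addnK => /(congr1 (fun n => n%:R : R)).
rewrite !natrM => <-.
rewrite /gegenbauer_coef exprD (exprNn 2).
have : 'C(i + j, j)%:R != 0 :> R by rewrite pnatr_eq0 -lt0n bin_gt0 leq_addl.
have := fact_neq0 i; have := fact_neq0 j.
have := sqrr_sign R i; rewrite expr2 => ss ? ? ?.
set u := (-1) ^+ i in ss *; set v := (-1) ^+ j; set r := rising _ _.
transitivity (u * u * (v * r * 2 ^+ i / (j`!%:R * i`!%:R))); last by rewrite ss mul1r.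
by field; apply/and3P; split.
Qed.

Lemma coef_gegenbauer0 alpha n i :
  (forall j, n <> i + j.*2)%N -> (gegenbauer alpha n)`_i = 0.
Proof.
move=> nij; rewrite gegenbauerE coef_sum big1// => j _.
rewrite coefZ coefXn; case: eqP => [ij|_]; last by rewrite mulr0.
rewrite bin_small ?mulr0n ?mul0r//.
have := nij j; lia.
Qed.

(** Case split for coefficientwise proofs: C_n has the parity of n, so a coefficient is either given
    by [gegenbauer_coef] or zero. *)
Variant gegenbauer_parity_spec n i : Prop :=
| GegenbauerParity j of n = (i + j.*2)%N
| GegenbauerNoParity of (forall j, n <> i + j.*2)%N.

Lemma gegenbauer_parityP n i : gegenbauer_parity_spec n i.
Proof.
have [/andP[ni /eqP e]|h] := boolP ((i <= n)%N && (odd (n - i) == false)).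
  by apply: (@GegenbauerParity _ _ (n - i)./2); lia.
by apply: GegenbauerNoParity => j; lia.
Qed.

Lemma coef_gegenbauer_gt alpha n i : (n < i)%N -> (gegenbauer alpha n)`_i = 0.
Proof. by move=> ni; apply: coef_gegenbauer0 => j; lia. Qed.

Lemma gegenbauer0 alpha : gegenbauer alpha 0 = 1.
Proof.
apply/polyP => i; rewrite coef1; case: i => [|i] /=.
  rewrite (coef_gegenbauer alpha 0 0) /gegenbauer_coef /rising big_ord0.
  by rewrite !fact0; field.
by rewrite coef_gegenbauer_gt.
Qed.

Lemma coef_gegenbauer_top alpha n :
  (gegenbauer alpha n)`_n = rising alpha n * 2 ^+ n / n`!%:R.
Proof.
have := coef_gegenbauer alpha n 0; rewrite addn0 => ->.
by rewrite /gegenbauer_coef fact0 addn0 expr0 !mul1r.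
Qed.

Lemma size_gegenbauer_le alpha n : (size (gegenbauer alpha n) <= n.+1)%N.
Proof. by apply/leq_sizeP => i; exact: coef_gegenbauer_gt. Qed.

Lemma size_gegenbauer alpha n : 0 < alpha -> size (gegenbauer alpha n) = n.+1.
Proof.
move=> a0; apply/eqP; rewrite eqn_leq size_gegenbauer_le/= ltnNge.
apply/negP => /leq_sizeP/(_ n (leqnn n))/eqP.
rewrite coef_gegenbauer_top mulf_eq0 invr_eq0 (negbTE (fact_neq0 n)) orbF.
by rewrite mulf_eq0 expf_eq0 pnatr_eq0 andbF orbF gt_eqF// rising_gt0.
Qed.

(** Splitting off the first factor of the rising factorial raises the parameter by one. *)
Lemma deriv_gegenbauer alpha n :
  (gegenbauer alpha n.+1)^`() = (2 * alpha) *: gegenbauer (alpha + 1) n.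
Proof.
apply/polyP => i; rewrite coef_deriv coefZ -[LHS]mulr_natr.
case: (gegenbauer_parityP n i) => [j ->|nij]; last first.
  by rewrite !coef_gegenbauer0 ?mul0r ?mulr0// => j; have := nij j; lia.
rewrite -addSn !coef_gegenbauer /gegenbauer_coef addSn risingSl exprS factS natrM.
have := fact_neq0 i; have := fact_neq0 j.
have : i.+1%:R != 0 :> R by rewrite pnatr_eq0.
move=> iS jn iN; field; rewrite iN jn /=.
by rewrite nat1r.
Qed.

(** Gegenbauer's differential operator. Its symmetry for the weight gives orthogonality, and its
    eigenvalues identify the factors of negative order. *)
Definition gegenbauer_op alpha p : {poly R} :=
  (1 - 'X^2) * p^`()^`() - (2 * alpha + 1) *: ('X * p^`()).

Lemma coef_gegenbauer_op alpha p i : (gegenbauer_op alpha p)`_i =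
  i.+2%:R * i.+1%:R * p`_i.+2 - i%:R * (i%:R + 2 * alpha) * p`_i.
Proof.
rewrite /gegenbauer_op coefB coefZ mulrBl mul1r coefB coefXnM coefXM !coef_deriv.
case: i => [|[|i]] /=.
- ring.
- ring.
by rewrite !subSS subn0; ring.
Qed.

Lemma gegenbauer_ode alpha n : gegenbauer_op alpha (gegenbauer alpha n) =
  - (n%:R * (n%:R + 2 * alpha)) *: gegenbauer alpha n.
Proof.
apply/polyP => i; rewrite coef_gegenbauer_op coefZ.
case: (gegenbauer_parityP n i) => [[|j] ->|nij]; last first.
- rewrite !coef_gegenbauer0; first by rewrite !mulr0 subrr.
  + by move=> j; have := nij j; lia.
  + by move=> j; have := nij j.+1; lia.
- have -> : (i + j.+1.*2 = i.+2 + j.*2)%N by lia.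
  rewrite coef_gegenbauer.
  have -> : (i.+2 + j.*2 = i + j.+1.*2)%N by lia.
  rewrite coef_gegenbauer /gegenbauer_coef.
  have -> : (i.+2 + j = (i + j.+1).+1)%N by lia.
  rewrite risingSr !exprS !factS !natrM.
  have -> : (i + j.+1.*2)%:R = i%:R + 2 * j.+1%:R :> R.
    by rewrite natrD -mul2n natrM.
  have -> : (i + j.+1)%:R = i%:R + j.+1%:R :> R by rewrite natrD.
  have := fact_neq0 i; have := fact_neq0 j.
  have : j.+1%:R != 0 :> R by rewrite pnatr_eq0.
  have : i.+1%:R != 0 :> R by rewrite pnatr_eq0.
  have : i.+2%:R != 0 :> R by rewrite pnatr_eq0.
  move: (i.+1%:R) (i.+2%:R) (j.+1%:R) => x y z x0 y0 z0 jn iN.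
  by field; rewrite iN jn x0 y0 z0.
by rewrite addn0 coef_gegenbauer_gt ?ltnS ?leqnSn//; ring.
Qed.

Lemma gegenbauerN alpha n x :
  (gegenbauer alpha n).[- x] = (-1) ^+ n * (gegenbauer alpha n).[x].
Proof.
rewrite !horner_coef mulr_sumr; apply: eq_bigr => i _.
case: (gegenbauer_parityP n i) => [j nE|nij]; last first.
  by rewrite coef_gegenbauer0// !mul0r mulr0.
have -> : (-1) ^+ n = (-1) ^+ i :> R.
  by rewrite [in LHS]nE exprD -mul2n exprM sqrrN expr1n expr1n mulr1.
by rewrite (exprNn x); ring.
Qed.

(** At t = 1 the differential equation loses its second-order term, so C_n(1) is a positive multiple
    of C_n'(1), hence of C_(n-1)^(alpha+1)(1). *)
Lemma horner1_gegenbauer_gt0 alpha n : 0 < alpha -> 0 < (gegenbauer alpha n).[1].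
Proof.
elim: n alpha => [|n IH] alpha a0; first by rewrite gegenbauer0 hornerE.
have a1 : 0 < alpha + 1 by lra.
have := congr1 (horner^~ 1) (gegenbauer_ode alpha n.+1).
rewrite /gegenbauer_op deriv_gegenbauer !hornerE/= !hornerE expr1n subrr mul0r.
have := IH _ a1; move: (_.[1]) (_.[1]) => c' c c0 e.
have n0 : 0 <= n%:R :> R by [].
have k0 : 0 < (2 * alpha + 1) * 2 * alpha * c by rewrite !mulr_gt0//; lra.
have k1 : 0 < n.+1%:R * (n.+1%:R + 2 * alpha) by rewrite mulr_gt0// ltr_wpDl//; lra.
rewrite -(pmulr_rgt0 _ k1); lra.
Qed.

Lemma derivn_gegenbauer alpha i k : (gegenbauer alpha (i + k))^`(i) =
  (2 ^+ i * rising alpha i) *: gegenbauer (alpha + i%:R) k.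
Proof.
elim: i k => [|i IH] k.
  by rewrite add0n derivn0 /rising big_ord0 expr0 addr0 mulr1 scale1r.
rewrite addSnnS derivnS IH derivZ deriv_gegenbauer scalerA -addrA natr1.
by congr (_ *: _); rewrite risingSr exprS; ring.
Qed.

(* Taylor expansion at 1, where all derivatives are positive. *)
Lemma gegenbauer_gt0 alpha n x : 0 < alpha -> 1 <= x -> 0 < (gegenbauer alpha n).[x].
Proof.
move=> a0 x1; have -> : x = 1 + (x - 1) by ring.
rewrite nderiv_taylor; last exact: mulrC.
rewrite size_gegenbauer// big_ord_recl/= expr0 mulr1 nderivn0.
rewrite ltr_pwDl ?horner1_gegenbauer_gt0// sumr_ge0// => i _.
rewrite mulr_ge0 ?exprn_ge0 ?subr_ge0//.
have := ltn_ord i; rewrite /bump leq0n add1n; move: (nat_of_ord i) => k kn.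
rewrite -(pmulrn_lge0 _ (fact_gt0 k.+1)) -hornerMn -nderivn_def.
rewrite -[n in gegenbauer _ n](subnKC kn) derivn_gegenbauer hornerZ mulr_ge0//; last first.
  by rewrite ltW// horner1_gegenbauer_gt0// ltr_wpDr.
by rewrite mulr_ge0 ?exprn_ge0// ltW// rising_gt0.
Qed.

(** Positivity on [1, oo) and parity exclude all other real zeros. Hence the nodes are interior and
    their sines do not vanish. *)
Lemma root_gegenbauer_lt1 alpha n x :
  0 < alpha -> root (gegenbauer alpha n) x -> -1 < x < 1.
Proof.
move=> a0 /eqP rx; apply/andP; split; rewrite ltNge; apply/negP => h.
  have := @gegenbauer_gt0 alpha n (- x) a0.
  by rewrite gegenbauerN rx mulr0 ltxx => /(_ _)/negP; apply=> //; lra.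
by have := @gegenbauer_gt0 alpha n x a0 h; rewrite rx ltxx.
Qed.

Lemma gegenbauer_op_half (c : R) p : gegenbauer_op (2^-1 + c) p =
  (1 - 'X^2) * p^`()^`() - (2 + 2 * c%:P) * ('X * p^`()).
Proof.
rewrite /gegenbauer_op -mul_polyC; congr (_ - _ * _).
have -> : 2 * (2^-1 + c) + 1 = 2 + 2 * c by field.
by rewrite polyCD polyCM rmorph_nat.
Qed.

(** Multiplication by (1 - t^2)^m carries eigenvectors for the parameter 1/2 + m to eigenvectors for
    1/2 - m and shifts the eigenvalue by 2 m. *)
Lemma gegenbauer_op_weight (m : nat) (lam : R) p :
  gegenbauer_op (2^-1 + m%:R) p = - (lam - 2 * m%:R) *: p ->
  gegenbauer_op (2^-1 - m%:R) ((1 - 'X^2) ^+ m * p) =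
    - lam *: ((1 - 'X^2) ^+ m * p).
Proof.
rewrite !gegenbauer_op_half -!mul_polyC.
set w := 1 - 'X^2 : {poly R}; set A := w ^+ m; set c := (m%:R)%:P => ode.
have dw : w^`() = - (2 * 'X).
  by rewrite /w derivB derivXn derivC sub0r/= mulr_natl.
(* This relation and its derivative below eliminate the derivatives of [A] without the exponent m -
   1. *)
have wA' : w * A^`() = - (2 * c * 'X * A).
  rewrite /A /c rmorph_nat deriv_exp dw; case: (m) => [|k] /=; first by rewrite mulr0n; ring.
  rewrite exprS -mulr_natr; ring.
have wA'' : w * A^`()^`() = 2 * 'X * A^`() - 2 * c * A - 2 * c * 'X * A^`().
  have := congr1 deriv wA'.
  have -> : 2 * c * 'X * A = (2 * m%:R) *: ('X * A).
    by rewrite -mul_polyC polyCM rmorph_nat; ring.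
  rewrite derivM derivN derivZ derivM derivX dw -mul_polyC polyCM rmorph_nat -/c => h.
  have -> : w * A^`()^`() = - (2 * 'X) * A^`() + w * A^`()^`() + 2 * 'X * A^`() by ring.
  rewrite h; ring.
rewrite !derivM !derivD !derivM.
have -> : w * (A^`()^`() * p + A^`() * p^`() + (A^`() * p^`() + A * p^`()^`())) =
  (w * A^`()^`()) * p + 2 * (w * A^`()) * p^`() + A * (w * p^`()^`()) by ring.
have -> : w * p^`()^`() = (2 + 2 * c) * ('X * p^`()) + (- (lam - 2 * m%:R))%:P * p.
  by rewrite -ode; ring.
rewrite wA'' wA' !polyCN polyCB polyCM rmorph_nat -/c; ring.
Qed.

(** Comparing leading coefficients, a solution of degree k < n would need n (n + 2 alpha) = k (k + 2
    alpha), that is (n - k) (n + k + 2 alpha) = 0. *)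
Lemma gegenbauer_ode_uniq alpha n p :
  (forall k, (k < n)%N -> n%:R + k%:R + 2 * alpha != 0) -> (size p <= n)%N ->
  gegenbauer_op alpha p = - (n%:R * (n%:R + 2 * alpha)) *: p -> p = 0.
Proof.
move=> nk sp ode; apply/eqP; apply/negPn/negP => p0.
have sp0 : (0 < size p)%N by rewrite size_poly_gt0.
have := congr1 (fun q : {poly R} => q`_(size p).-1) ode.
rewrite coef_gegenbauer_op coefZ.
have -> : p`_(size p).-1.+2 = 0 by rewrite nth_default// (leq_trans (leqSpred _)).
have : p`_(size p).-1 != 0 by rewrite -lead_coefE lead_coef_eq0.
have kn : ((size p).-1 < n)%N by rewrite prednK.
move: (size p).-1 kn => k kn pk /eqP.
rewrite mulr0 sub0r mulNr eqr_opp => /eqP/(mulIf pk)/eqP.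
rewrite -subr_eq0.
have -> : k%:R * (k%:R + 2 * alpha) - n%:R * (n%:R + 2 * alpha) =
  - ((n%:R - k%:R) * (n%:R + k%:R + 2 * alpha)) by ring.
by rewrite oppr_eq0 mulf_eq0 (negbTE (nk _ kn)) orbF subr_eq0 eqr_nat; apply/negP; lia.
Qed.

Lemma coef_weight_top (m k : nat) p : (size p <= k.+1)%N ->
  (size ((1 - 'X^2) ^+ m * p)%R <= (2 * m + k).+1)%N /\
  ((1 - 'X^2) ^+ m * p)`_(2 * m + k) = (-1) ^+ m * p`_k.
Proof.
move=> sp; have wE q : (1 - 'X^2) * q = q - 'X^2 * q by rewrite mulrBl mul1r.
set w := 1 - 'X^2 in wE *; elim: m => [|m [sm cm]]; first by rewrite !expr0 !mul1r.
rewrite !exprS -!mulrA; set q := _ ^+ m * p in sm cm *.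
have -> : (2 * m.+1 + k = (2 * m + k).+2)%N by lia.
rewrite wE.
have hq i : (2 * m + k < i)%N -> q`_i = 0.
  by move=> ki; rewrite nth_default// (leq_trans sm).
split; last by rewrite coefB coefXnM /= hq; [rewrite subSS subn1 /= cm; ring|lia].
apply/leq_sizeP => i hi; rewrite coefB coefXnM !hq; [|lia|lia].
by rewrite if_same subrr.
Qed.

Lemma rising_half (m : nat) :
  rising (2^-1 - m%:R) m = (-1) ^+ m * rising 2^-1 m.
Proof.
rewrite /rising (reindex_inj rev_ord_inj)/=.
have -> : (-1) ^+ m = \prod_(i < m) (-1 : R) by rewrite big_const_ord iter_mulr_1.
rewrite -big_split/=; apply: eq_bigr => i _.
by rewrite natrB ?ltn_ord// -[i.+1%:R]natr1; field.
Qed.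

(* Both sides solve the same Gegenbauer equation, whose polynomial solutions are
   determined by their coefficient of degree a + m. *)
Lemma gegenbauer_neg_order (a m : nat) : (m <= a)%N ->
  gegenbauer (2^-1 - m%:R) (a + m) =
  (2 ^+ (2 * m) * rising 2^-1 m ^+ 2 * (a - m)`!%:R / (a + m)`!%:R)
  *: ((1 - 'X^2) ^+ m * gegenbauer (2^-1 + m%:R) (a - m)).
Proof.
move=> ma; set c := _ / _; set p := gegenbauer (2^-1 + m%:R) (a - m).
have am : (2 * m + (a - m) = a + m)%N by lia.
have := coef_weight_top m (size_gegenbauer_le (2^-1 + m%:R) (a - m)).
rewrite -/p am => -[s2 c2]; apply/eqP; rewrite -subr_eq0; apply/eqP.
apply: (@gegenbauer_ode_uniq (2^-1 - m%:R) (a + m)).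
- move=> k kn; have -> : (a + m)%:R + k%:R + 2 * (2^-1 - m%:R) = (a - m)%:R + k.+1%:R :> R.
    by rewrite natrB// natrD -natr1; field.
  by rewrite -natrD pnatr_eq0; lia.
(* The constant [c] is the one that cancels the coefficients of degree a + m. *)
- apply/leq_sizeP => i; rewrite leq_eqVlt => /predU1P[<-|hi]; last first.
    rewrite coefB coefZ coef_gegenbauer_gt// nth_default ?mulr0 ?subr0//.
    exact: leq_trans s2 hi.
  rewrite coefB coefZ c2 !coef_gegenbauer_top -[in rising _ (a + m)]am risingD.
  have -> : rising (2^-1 - m%:R) (2 * m) = (-1) ^+ m * rising 2^-1 m ^+ 2.
    by rewrite mul2n -addnn risingD rising_half subrK; ring.
  have -> : 2^-1 - m%:R + (2 * m)%:R = 2^-1 + m%:R :> R by rewrite natrM; ring.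
  rewrite -am exprD /c am.
  have := fact_neq0 (a + m); have := fact_neq0 (a - m) => ? ?.
  by field; apply/andP; split.
have -> : gegenbauer_op (2^-1 - m%:R) (gegenbauer (2^-1 - m%:R) (a + m) -
    c *: ((1 - 'X^2) ^+ m * p)) =
  gegenbauer_op (2^-1 - m%:R) (gegenbauer (2^-1 - m%:R) (a + m)) -
  c *: gegenbauer_op (2^-1 - m%:R) ((1 - 'X^2) ^+ m * p).
  by rewrite /gegenbauer_op !derivB !derivZ -!mul_polyC; ring.
(* The eigenvalues match because (a + m) (a - m + 1) - 2 m = (a - m) (a + m + 1). *)
rewrite (@gegenbauer_op_weight m ((a + m)%:R * ((a + m)%:R + 2 * (2^-1 - m%:R)))).
  by rewrite gegenbauer_ode scalerBr !scalerA [c * _]mulrC.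
rewrite /p gegenbauer_ode; congr (_ *: _).
by rewrite natrB// natrD; field.
Qed.

End GegenbauerAlgebra.

(** * The Gegenbauer weights with half-integer parameter *)

Section WeightedIntegral.
Variable R : realType.
Implicit Types (p q : {poly R}) (s : R).
Local Notation mu := (@lebesgue_measure R).

(** This is sin theta at s = cos theta. Its natural powers stand for the half-integer powers of 1 -
    s^2 and stay continuous at both ends. *)
Definition circ s : R := Num.sqrt (1 - s ^+ 2).

(* The integral for the Gegenbauer weight (1 - s^2)^(alpha - 1/2) with
   alpha = (n + 1) / 2. *)
Definition wint (n : nat) p : R :=
  (\int[mu]_(s in `[(-1)%R, 1%R]) (circ s ^+ n * p.[s]))%R.

Lemma continuous_circ : continuous circ.
Proof.
move=> s; apply: (@continuous_comp _ _ _ (fun s : R => 1 - s ^+ 2) Num.sqrt).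
  by apply: cvgB; [exact: cvg_cst|exact: exprn_continuous].
exact: sqrt_continuous.
Qed.

Lemma continuous_circX_horner n p : continuous (fun s => circ s ^+ n * p.[s]).
Proof.
move=> s; apply: (@continuousM _ _ (fun s => circ s ^+ n) (horner p)); last first.
  exact: continuous_horner.
apply: (@continuous_comp _ _ _ circ (fun x : R => x ^+ n)).
  exact: continuous_circ.
exact: exprn_continuous.
Qed.

Lemma integrable_circX_horner n p :
  mu.-integrable `[(-1)%R, 1%R] (EFin \o (fun s => circ s ^+ n * p.[s])).
Proof.
apply: continuous_compact_integrable; first exact: segment_compact.
by apply: continuous_subspaceT; exact: continuous_circX_horner.
Qed.

Lemma wintD n p q : wint n (p + q) = wint n p + wint n q.
Proof.
rewrite /wint -RintegralD//; [|exact: integrable_circX_horner..].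
by apply: eq_Rintegral => s _; rewrite hornerD mulrDr.
Qed.

Lemma wintZ n a p : wint n (a *: p) = a * wint n p.
Proof.
rewrite /wint -RintegralZl//; last exact: integrable_circX_horner.
by apply: eq_Rintegral => s _; rewrite hornerZ mulrCA.
Qed.

Lemma wint0 n : wint n 0 = 0.
Proof. by rewrite -(scale0r 0) wintZ mul0r. Qed.

Lemma wintN n p : wint n (- p) = - wint n p.
Proof. by rewrite -scaleN1r wintZ mulN1r. Qed.

Lemma wintB n p q : wint n (p - q) = wint n p - wint n q.
Proof. by rewrite wintD wintN. Qed.

Lemma wint_sum n (I : Type) (r : seq I) (P : pred I) (F : I -> {poly R}) :
  wint n (\sum_(i <- r | P i) F i) = \sum_(i <- r | P i) wint n (F i).
Proof. exact: (big_morph _ (wintD n) (wint0 n)). Qed.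

Lemma circ_sqr s : s \in `[(-1)%R, 1%R] -> circ s ^+ 2 = 1 - s ^+ 2.
Proof.
rewrite in_itv/= => /andP[s1 s2]; rewrite sqr_sqrtr// subr_ge0.
by rewrite -ler_sqrt// sqrtr1 sqrtr_sqr ler_norml s1.
Qed.

(** A polynomial factor (1 - s^2)^m amounts to raising the parameter alpha by m. *)
Lemma wint_weight n m p : wint n ((1 - 'X^2) ^+ m * p) = wint (n + 2 * m) p.
Proof.
apply: eq_Rintegral => s; rewrite inE/= => /circ_sqr sE.
rewrite hornerM horner_exp exprD mul2n -muln2 mulnC exprM sE mulrA.
by rewrite !hornerE.
Qed.

Lemma is_derive_circX_horner n p s : s \in `](-1)%R, 1%R[ ->
  is_derive s 1 (fun s => circ s ^+ n.+2 * p.[s])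
   (circ s ^+ n * ((1 - 'X^2) * p^`() - n.+2%:R *: ('X * p)).[s]).
Proof.
move=> s1.
have s1' : s \in `[(-1)%R, 1%R] by apply: subset_itv_oo_cc.
have c2 := circ_sqr s1'.
have w0 : 0 < 1 - s ^+ 2.
  move: s1; rewrite in_itv/= => /andP[s1 s2]; nra.
have c0 : circ s != 0 by rewrite gt_eqF// sqrtr_gt0.
have dw : is_derive s (1 : R) (fun s : R => 1 - s ^+ 2) (- (2 * s)).
  have -> : (fun s : R => 1 - s ^+ 2) = horner (1 - 'X^2).
    by apply/funext => x; rewrite !hornerE.
  apply: is_derive_eq.
  by rewrite derivB derivC derivXn /= sub0r hornerN hornerMn hornerX mulr_natl.
have dc : is_derive s 1 circ ((2 * circ s)^-1 * - (2 * s)).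
  exact: (@is_derive1_comp _ Num.sqrt (fun s : R => 1 - s ^+ 2) s _ _ (is_derive1_sqrt w0) dw).
have dX := is_derive1_comp (is_derive_poly 'X^(n.+2) (circ s)) dc.
have dp := is_derive_poly p s.
rewrite (_ : (fun _ => _) = (horner 'X^(n.+2) \o circ) * horner p); last first.
  by apply/funext => x /=; rewrite fctE /= hornerXn.
apply: (is_derive_eq (is_deriveM dX dp)).
rewrite derivXn /= hornerMn !hornerXn !hornerE -/(circ s) /= -c2 !exprS.
rewrite /GRing.scale/=.
by field.
Qed.

(** The integrand is the derivative of [circ s ^+ n.+2 * p.[s]], which vanishes at both ends. All
    integrations by parts for these weights go through this identity. *)
Lemma wint_parts n p :
  wint n ((1 - 'X^2) * p^`() - n.+2%:R *: ('X * p)) = 0.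
Proof.
pose F s := circ s ^+ n.+2 * p.[s].
have F0 s : 1 - s ^+ 2 = 0 -> F s = 0.
  by move=> e; rewrite /F /circ e sqrtr0 expr0n mul0r.
rewrite /wint /Rintegral (@continuous_FTC2 _ _ F).
- by rewrite !F0 ?subee//= ?sqrrN expr1n subrr.
- lra.
- by apply: continuous_subspaceT; exact: continuous_circX_horner.
- split.
  + by move=> s /(is_derive_circX_horner n p)[].
  + by apply: cvg_at_right_filter; exact: continuous_circX_horner.
  + by apply: cvg_at_left_filter; exact: continuous_circX_horner.
- by move=> s /(is_derive_circX_horner n p)[d e]; rewrite derive1E.
Qed.

Lemma wint01 : wint 0 1 = 2.
Proof.
rewrite /wint /Rintegral (@continuous_FTC2 _ _ id).
- by rewrite /=; ring.
- lra.
- by apply: continuous_subspaceT; exact: continuous_circX_horner.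
- split; first by move=> s _; exact: derivable_id.
  + by apply: cvg_at_right_filter; exact: cvg_id.
  + by apply: cvg_at_left_filter; exact: cvg_id.
- by move=> s _; rewrite derive1_id hornerC mulr1.
Qed.

Lemma wint11 : wint 1 1 = pi / 2.
Proof.
rewrite /wint /Rintegral.
(* The ends are written as cosines to prepare the substitution s = cos x, which leaves the integral
   of sin^2 over [0, pi]. *)
have -> : (\int[mu]_(s in `[(-1)%R, 1%R]) (circ s ^+ 1 * (1 : {poly R}).[s])%:E)%E =
  (\int[mu]_(s in `[cos pi, cos 0]) (circ s)%:E)%E.
  rewrite cospi cos0; apply: eq_integral => s _.
  by rewrite hornerC mulr1 expr1.
have dcos : (@cos R)^`()%classic = - sin.
  by apply/funext => x; rewrite derive1E derive_val.
rewrite integration_by_substitution_decreasing.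
- rewrite dcos opprK.
  pose F x : R := (x - sin x * cos x) / 2.
  have dF x : is_derive x (1 : R) F (sin x ^+ 2).
    rewrite /F; apply: is_derive_eq.
    have := cos2Dsin2 x; rewrite /GRing.scale/=.
    move: (cos x) (sin x) => c s cs; rewrite mulr0 mulr0 add0r.
    transitivity (2^-1 * (c ^+ 2 + s ^+ 2 - (s * - s + c * c))); first by rewrite cs.
    by field.
  rewrite (@continuous_FTC2 _ ((circ \o cos) * sin) F).
  + rewrite /= /F cospi sinpi sin0 !mul0r; ring.
  + exact: pi_gt0.
  + apply: continuous_subspaceT => x; apply: (@continuousM _ _ (circ \o cos) sin).
      by apply: continuous_comp; [exact: continuous_cos|exact: continuous_circ].
    exact: continuous_sin.
  + have cF x : {for x, continuous F}.
      by apply/differentiable_continuous/derivable1_diffP; case: (dF x).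
    split; first by move=> x _; case: (dF x).
    * by apply: cvg_at_right_filter; exact: cF.
    * by apply: cvg_at_left_filter; exact: cF.
  + move=> x; rewrite in_itv/= => /andP[x0 xpi].
    rewrite derive1E; case: (dF x) => _ ->.
    rewrite fctE /circ /= -sin2cos2 sqrtr_sqr ger0_norm ?expr2//.
    by rewrite sin_ge0_pi// !ltW.
- exact: pi_ge0.
- by move=> x y xI yI; rewrite ltr_cos.
- by rewrite dcos => x _; apply: continuousN; exact: continuous_sin.
- rewrite dcos; apply: cvgP; apply: cvg_at_right_filter; apply: continuousN.
  exact: continuous_sin.
- rewrite dcos; apply: cvgP; apply: cvg_at_left_filter; apply: continuousN.
  exact: continuous_sin.
- split; first by move=> x _; exact: ex_derive.
  + by apply: cvg_at_right_filter; exact: continuous_cos.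
  + by apply: cvg_at_left_filter; exact: continuous_cos.
- by apply: continuous_subspaceT; exact: continuous_circ.
Qed.

End WeightedIntegral.

(** * Gamma at half-integers *)

Section GammaHalfInteger.
Variable R : realType.
Implicit Types (x u : R) (K N : nat).
Local Notation mu := (@lebesgue_measure R).

(* The integrand of Euler's integral at (K + 1) / 2 after the substitution
   t = u^2, which removes the singularity at 0. *)
Definition gmoment K u : R := 2 * u ^+ K * expR (- u ^+ 2).

(** The truncation stays away from 0 because Euler's integrand, before the substitution, may be
    singular there. *)
Definition gmoment_int K N : R :=
  (\int[mu]_(u in `[N.+1%:R^-1, N.+1%:R]) gmoment K u)%R.

Lemma continuous_gmoment K : continuous (gmoment K).
Proof.
move=> u; apply: (@continuousM _ _ (fun u => 2 * u ^+ K) (fun u : R => expR (- u ^+ 2))).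
  by apply: cvgMr; exact: exprn_continuous.
exact: continuous_gauss_fun.
Qed.

Lemma measurable_gmoment K (D : set R) : measurable_fun D (gmoment K).
Proof.
apply: measurable_funTS; apply: continuous_measurable_fun.
exact: continuous_gmoment.
Qed.

Lemma integrable_gmoment K (a b : R) :
  mu.-integrable `[a, b] (EFin \o gmoment K).
Proof.
apply: continuous_compact_integrable; first exact: segment_compact.
by apply: continuous_subspaceT; exact: continuous_gmoment.
Qed.

Lemma gmoment_int_EFin K N :
  (\int[mu]_(u in `[(N.+1%:R^-1)%R, N.+1%:R%R]) (gmoment K u)%:E)%E =
  (gmoment_int K N)%:E.
Proof.
rewrite /gmoment_int /Rintegral fineK//; apply: integrable_fin_num => //.
exact: integrable_gmoment.
Qed.

Lemma itv_invS_le N : N.+1%:R^-1 <= N.+1%:R :> R.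
Proof. by rewrite (@le_trans _ _ 1)// ?invf_le1// ler1n. Qed.

Lemma is_derive_gaussX K u :
  is_derive u 1 (fun u : R => u ^+ K * expR (- u ^+ 2))
    (K%:R * u ^+ K.-1 * expR (- u ^+ 2) - gmoment K.+1 u).
Proof.
have d1 : is_derive u 1 (fun u : R => - u ^+ 2) (- (2 * u)).
  have -> : (fun u : R => - u ^+ 2) = horner (- 'X^2).
    by apply/funext => x; rewrite !hornerE.
  apply: is_derive_eq.
  by rewrite derivN derivXn /= hornerN hornerMn hornerX mulr_natl.
have d2 : is_derive u 1 (fun u : R => u ^+ K) (K%:R * u ^+ K.-1).
  have -> : (fun u : R => u ^+ K) = horner 'X^K.
    by apply/funext => x; rewrite !hornerE.
  apply: is_derive_eq.
  by rewrite derivXn hornerMn hornerXn mulr_natl.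
have d3 := @is_derive1_comp _ expR (fun u : R => - u ^+ 2) u _ _ (is_derive_expR (- u ^+ 2)) d1.
apply: (is_derive_eq (is_deriveM d2 d3)).
by rewrite /gmoment /GRing.scale/= (exprS u K); ring.
Qed.

Lemma gmoment_FTC K N :
  (\int[mu]_(u in `[N.+1%:R^-1, N.+1%:R])
    (K%:R * u ^+ K.-1 * expR (- u ^+ 2) - gmoment K.+1 u))%R =
  N.+1%:R ^+ K * expR (- N.+1%:R ^+ 2) -
  N.+1%:R^-1 ^+ K * expR (- N.+1%:R^-1 ^+ 2).
Proof.
(* For N = 0 the interval is the single point 1, which the fundamental theorem of calculus, stated
   for a < b, does not cover. *)
case: N => [|N].
  by rewrite invr1 subrr set_itv1 Rintegral_set1.
have cF : continuous (fun u : R => u ^+ K * expR (- u ^+ 2)).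
  move=> u; apply/differentiable_continuous/derivable1_diffP.
  by case: (is_derive_gaussX K u).
rewrite /Rintegral (@continuous_FTC2 _ _ (fun u : R => u ^+ K * expR (- u ^+ 2))) //.
- by rewrite (@lt_trans _ _ 1)// ?invf_lt1// ltr1n.
- apply: continuous_subspaceT => u; apply: cvgB; last exact: continuous_gmoment.
  apply: (@continuousM _ _ (fun u : R => K%:R * u ^+ K.-1) (fun u : R => expR (- u ^+ 2))).
    by apply: cvgMr; exact: exprn_continuous.
  exact: continuous_gauss_fun.
- split; first by move=> u _; case: (is_derive_gaussX K u).
  + by apply: cvg_at_right_filter; exact: cF.
  + by apply: cvg_at_left_filter; exact: cF.
- by move=> u _; rewrite derive1E; case: (is_derive_gaussX K u).
Qed.

(** The truncated form of Gamma(a + 1) = a Gamma(a) at a = (K + 1) / 2, with the boundary terms of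
    the integration by parts. *)
Lemma gmoment_rec K N : gmoment_int K.+2 N = K.+1%:R / 2 * gmoment_int K N -
  (N.+1%:R ^+ K.+1 * expR (- N.+1%:R ^+ 2) -
  N.+1%:R^-1 ^+ K.+1 * expR (- N.+1%:R^-1 ^+ 2)).
Proof.
rewrite -gmoment_FTC RintegralB//.
- rewrite -/(gmoment_int K.+2 N).
  rewrite opprB; set I := Rintegral _ _ _.
  have -> : I = K.+1%:R / 2 * gmoment_int K N; last by ring.
  rewrite -RintegralZl//; last exact: integrable_gmoment.
  by apply: eq_Rintegral => u _; rewrite /gmoment /=; field.
- rewrite (_ : (fun _ => _) = (fun u => K.+1%:R / 2 * gmoment K u)); last first.
    by apply/funext => u; rewrite /gmoment /=; field.
  apply: continuous_compact_integrable; first exact: segment_compact.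
  apply: continuous_subspaceT => u; apply: cvgMr; exact: continuous_gmoment.
- exact: integrable_gmoment.
Qed.

Lemma cvg_gaussX_nat K :
  (N.+1%:R ^+ K * expR (- N.+1%:R ^+ 2) : R) @[N --> \oo] --> (0 : R).
Proof.
apply: (@squeeze_cvgr _ _ _ _ (fun=> 0) (fun N => K.+1`!%:R * N.+1%:R^-1)).
- near=> N; rewrite mulr_ge0 ?exprn_ge0 ?expR_ge0//=.
  rewrite expRN ler_pdivrMr ?expR_gt0//.
  (* Bounding the power K + 1 rather than K leaves a factor 1 / (N + 1) that tends to 0. *)
  have h : (N.+1%:R : R) ^+ K.+1 <= K.+1`!%:R * expR (N.+1%:R ^+ 2).
    rewrite mulrC -ler_pdivrMr ?ltr0n ?fact_gt0//.
    rewrite (@le_trans _ _ (expR N.+1%:R))//.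
      by apply: le_trans (expR_ge1Dxn K _); rewrite ?lerDr.
    by rewrite ler_expR expr2 ler_peMr// ler1n.
  rewrite mulrAC ler_pdivlMr ?ltr0n//.
  by rewrite -exprSr.
- exact: cvg_cst.
- rewrite -[0](mulr0 (K.+1`!%:R : R)); apply: cvgMr.
  exact: cvg_harmonic.
Unshelve. all: by end_near. Qed.

Lemma cvg_gaussX_inv K :
  (N.+1%:R^-1 ^+ K.+1 * expR (- N.+1%:R^-1 ^+ 2) : R) @[N --> \oo] --> (0 : R).
Proof.
apply: (@squeeze_cvgr _ _ _ _ (fun=> 0) (fun N => N.+1%:R^-1)).
- near=> N; rewrite mulr_ge0 ?exprn_ge0 ?expR_ge0//=.
  rewrite exprS -mulrA ler_piMr// mulr_ile1 ?exprn_ge0 ?expR_ge0//.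
    by rewrite exprn_ile1// invf_le1// ler1n.
- exact: cvg_cst.
- exact: cvg_harmonic.
Unshelve. all: by end_near. Qed.

Lemma cvg_gmoment_rec K (l : R) : gmoment_int K N @[N --> \oo] --> l ->
  gmoment_int K.+2 N @[N --> \oo] --> K.+1%:R / 2 * l.
Proof.
move=> Kl; rewrite (_ : gmoment_int K.+2 = fun N => K.+1%:R / 2 * gmoment_int K N -
  (N.+1%:R ^+ K.+1 * expR (- N.+1%:R ^+ 2) -
  N.+1%:R^-1 ^+ K.+1 * expR (- N.+1%:R^-1 ^+ 2))); last first.
  by apply/funext => N; exact: gmoment_rec.
rewrite -[X in _ --> X]subr0 -[X in _ - X](subr0 0).
apply: cvgB; first exact: cvgMr.
apply: cvgB; [exact: cvg_gaussX_nat|exact: cvg_gaussX_inv].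
Qed.

(** The exponent makes the family stable under t = u^2: k = 1 gives the intervals for u, and k = 2
    their images for t. *)
Definition itv_exhaust (k N : nat) : set R :=
  `[N.+1%:R^-1 ^+ k, N.+1%:R ^+ k]%classic.

Lemma bigcup_itv_exhaust k : \bigcup_N itv_exhaust k.+1 N = `]0%R, +oo[%classic.
Proof.
apply/seteqP; split => x /=.
  move=> [N _]; rewrite /itv_exhaust /= !in_itv/= andbT => /andP[h _].
  by rewrite (lt_le_trans _ h)// exprn_gt0// invr_gt0.
rewrite in_itv/= andbT => x0.
have hb : x <= (Num.bound (x + x^-1)).+1%:R /\ x^-1 <= (Num.bound (x + x^-1)).+1%:R.
  have xV0 : 0 < x^-1 by rewrite invr_gt0.
  have := archi_boundP (ltW (addr_gt0 x0 xV0)); rewrite -natr1.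
  move: (_%:R) => b; lra.
exists (Num.bound (x + x^-1)) => //; rewrite /itv_exhaust /= in_itv/=.
move: (Num.bound _) hb => N [h1 h2].
have N1 : 1 <= N.+1%:R :> R by rewrite ler1n.
apply/andP; split.
  rewrite exprVn -[leRHS]invrK lef_pV2 ?posrE ?invr_gt0 ?exprn_gt0//.
  by rewrite (le_trans h2)// exprS ler_peMr// exprn_ege1.
by rewrite (le_trans h1)// exprS ler_peMr// exprn_ege1.
Qed.

Lemma nondecreasing_itv_exhaust k : nondecreasing_seq (itv_exhaust k).
Proof.
move=> m n mn; rewrite subsetEset /itv_exhaust; apply: subset_itvScc; rewrite bnd_simp.
  by rewrite lerXn2r// ?nnegrE ?invr_ge0// lef_pV2 ?posrE// ler_nat.
by rewrite lerXn2r// ?nnegrE// ler_nat.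
Qed.

Lemma cvg_itv_exhaust k (f : R -> R) : measurable_fun `](0 : R), +oo[ f ->
  (forall x, 0 < x -> 0 <= f x) ->
  (\int[mu]_(x in itv_exhaust k.+1 N) (f x)%:E)%E @[N --> \oo] -->
  (\int[mu]_(x in `]0%R, +oo[) (f x)%:E)%E.
Proof.
move=> mf f0; rewrite -(bigcup_itv_exhaust k).
have sub N : itv_exhaust k.+1 N `<=` `]0%R, +oo[.
  by rewrite -(bigcup_itv_exhaust k); exact: bigcup_sup.
apply: ge0_nondecreasing_set_cvg_integral.
- exact: nondecreasing_itv_exhaust.
- by move=> N; exact: measurable_itv.
- move=> N; apply/measurable_EFinP; apply: measurable_funS mf => //.
- by move=> N x /sub; rewrite /= in_itv/= andbT lee_fin => /f0.
Qed.

(** The recurrence has step two and needs two starting values: this one from an elementary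
    primitive, [cvg_gmoment0] from the Gaussian integral. *)
Lemma cvg_gmoment1 : gmoment_int 1 N @[N --> \oo] --> (1 : R).
Proof.
have h N : gmoment_int 1 N =
  expR (- N.+1%:R^-1 ^+ 2) - N.+1%:R ^+ 0 * expR (- N.+1%:R ^+ 2).
  have := gmoment_FTC 0 N; rewrite /= !expr0 !mul1r => h.
  rewrite -[LHS]opprK -[RHS]opprK opprB -h; congr (- _).
  rewrite /gmoment_int -mulN1r -RintegralZl//; last exact: integrable_gmoment.
  by apply: eq_Rintegral => u _; ring.
rewrite (_ : gmoment_int 1 = fun N =>
  expR (- N.+1%:R^-1 ^+ 2) - N.+1%:R ^+ 0 * expR (- N.+1%:R ^+ 2)); last first.
  by apply/funext => N; exact: h.
rewrite -[X in _ --> X]subr0; apply: cvgB; last exact: cvg_gaussX_nat.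
rewrite -[X in _ --> X]expR0 -[X in _ --> expR X]oppr0 -[X in _ --> expR (- X)](expr0n _ 2).
apply: (@cvg_comp _ _ _ (fun N => N.+1%:R^-1) (fun u : R => expR (- u ^+ 2))).
  exact: cvg_harmonic.
exact: continuous_gauss_fun.
Qed.

Lemma cvg_gmoment0 : gmoment_int 0 N @[N --> \oo] --> (Num.sqrt pi : R).
Proof.
have h : (\int[mu]_(x in itv_exhaust 1 N) (gmoment 0 x)%:E)%E @[N --> \oo] -->
    (Num.sqrt pi : R)%:E.
  have -> : (Num.sqrt pi : R)%:E = (\int[mu]_(x in `]0%R, +oo[) (gmoment 0 x)%:E)%E.
    rewrite integral_itv_obnd_cbnd; last first.
      by apply/measurable_EFinP; exact: measurable_gmoment.
    under eq_integral do rewrite /gmoment expr0 mulr1 EFinM.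
    rewrite ge0_integralZl//=; first by rewrite integral0y_gauss -EFinM; congr EFin; field.
    - by apply/measurable_EFinP; apply: measurable_funTS; exact: measurable_gauss_fun.
  apply: cvg_itv_exhaust.
    exact: measurable_gmoment.
  by move=> x _; rewrite /gmoment expr0 mulr1 mulr_ge0// expR_ge0.
have h2 N : (\int[mu]_(x in itv_exhaust 1 N) (gmoment 0 x)%:E)%E = (gmoment_int 0 N)%:E.
  by rewrite -gmoment_int_EFin /itv_exhaust !expr1.
move: h; under eq_cvg do rewrite h2.
by move/fine_cvg.
Qed.

Definition gamma_integrand (a t : R) : R := t `^ (a - 1) * expR (- t).

Lemma powR_sqr_half (k : nat) (u : R) : 0 < u ->
  (u ^+ 2) `^ (k.+1%:R / 2 - 1) * (2 * u) = 2 * u ^+ k.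
Proof.
move=> u0; rewrite -(powR_mulrn 2 (ltW u0)) -powRrM mulrCA; congr (_ * _).
rewrite -[X in _ * X](powRr1 (ltW u0)) -powRD; last by apply/implyP => _; rewrite gt_eqF.
rewrite -(powR_mulrn k (ltW u0)); congr (_ `^ _).
by rewrite -natr1; field.
Qed.

Lemma gamma_substitution k N :
  (\int[mu]_(t in itv_exhaust 2 N) (gamma_integrand (k.+1%:R / 2) t)%:E)%E =
  (gmoment_int k N)%:E.
Proof.
pose F (u : R) : R := u ^+ 2.
have dF : F^`()%classic = (fun u => 2 * u).
  have -> : F = horner 'X^2 by apply/funext => u; rewrite hornerXn.
  by rewrite -derivE derivXn; apply/funext => u; rewrite hornerMn hornerX mulr_natl.
have cF : continuous F by exact: exprn_continuous.
have c2 : continuous (fun u : R => 2 * u) by move=> u; apply: cvgMr; exact: cvg_id.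
have a0 : 0 < N.+1%:R^-1 :> R by rewrite invr_gt0.
rewrite -gmoment_int_EFin /itv_exhaust -!/(F _).
rewrite (@integration_by_substitution_increasing _ F).
- apply: eq_integral => u; rewrite inE/= in_itv/= => /andP[u1 u2].
  have u0 : 0 < u by exact: lt_le_trans u1.
  rewrite dF fctE /= /F /gamma_integrand /gmoment -powR_sqr_half//.
  by congr EFin; ring.
- exact: itv_invS_le.
- move=> x y; rewrite !in_itv/= => /andP[x1 _] /andP[y1 _] xy.
  have x0 : 0 < x by exact: lt_le_trans x1.
  by rewrite /F ltrXn2r ?nnegrE//= ltW// (lt_trans x0).
- by rewrite dF => u _; exact: c2.
- by rewrite dF; apply: cvgP; apply: cvg_at_right_filter; exact: c2.
- by rewrite dF; apply: cvgP; apply: cvg_at_left_filter; exact: c2.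
- split.
  + by move=> u _; exact: exprn_derivable.
  + by apply: cvg_at_right_filter; exact: cF.
  + by apply: cvg_at_left_filter; exact: cF.
- apply: continuous_in_subspaceT => u; rewrite inE/= in_itv/= => /andP[u1 _].
  have u0 : 0 < u by apply: lt_le_trans u1; rewrite exprn_gt0.
  apply: (@continuousM _ _ (fun t => t `^ (k.+1%:R / 2 - 1)) (fun t : R => expR (- t))).
    apply/differentiable_continuous/derivable1_diffP.
    by case: (is_derive1_powR (k.+1%:R / 2 - 1) u0).
  apply: (@continuous_comp _ _ _ -%R expR); last exact: continuous_expR.
  exact: opp_continuous.
Qed.

(** By monotone convergence the truncated integrals tend to the integral over the half-line in the
    extended reals; uniqueness of limits yields its value and its finiteness together. *)
Lemma gamma_int_cvg k (l : R) : gmoment_int k N @[N --> \oo] --> l ->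
  gamma_int (k.+1%:R / 2) = l.
Proof.
move=> kl; have h : (\int[mu]_(t in itv_exhaust 2 N)
    (gamma_integrand (k.+1%:R / 2) t)%:E)%E @[N --> \oo] --> l%:E.
  by under eq_cvg do rewrite gamma_substitution; apply: cvg_EFin => //; exact: nearW.
have h2 : (\int[mu]_(t in itv_exhaust 2 N)
    (gamma_integrand (k.+1%:R / 2) t)%:E)%E @[N --> \oo] -->
    (\int[mu]_(t in `]0%R, +oo[) (gamma_integrand (k.+1%:R / 2) t)%:E)%E.
  apply: cvg_itv_exhaust.
    apply: measurable_funM; first by apply: measurable_funTS; exact: measurable_powR.
    apply/measurable_funTS/measurableT_comp => //; exact: measurable_expR.
  by move=> x _; rewrite mulr_ge0 ?powR_ge0 ?expR_ge0.
by rewrite /gamma_int /Rintegral (cvg_unique _ h2 h).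
Qed.

Lemma cvg_gmoment k : exists l : R, gmoment_int k N @[N --> \oo] --> l.
Proof.
have [h _] : (exists l : R, gmoment_int k N @[N --> \oo] --> l) /\
  (exists l : R, gmoment_int k.+1 N @[N --> \oo] --> l); last exact: h.
elim: k => [|k [[l kl] h]].
  by split; [exists (Num.sqrt pi); exact: cvg_gmoment0|exists 1; exact: cvg_gmoment1].
by split=> //; exists (k.+1%:R / 2 * l); exact: cvg_gmoment_rec.
Qed.

Lemma gamma_int_half : gamma_int (1 / 2) = Num.sqrt pi :> R.
Proof. by apply: (@gamma_int_cvg 0); exact: cvg_gmoment0. Qed.

Lemma gamma_int_1 : gamma_int 1 = 1 :> R.
Proof.
rewrite -[X in gamma_int X](@divff _ 2)//; apply: (@gamma_int_cvg 1).
exact: cvg_gmoment1.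
Qed.

Lemma gamma_int_rec k :
  gamma_int (k.+1%:R / 2 + 1) = k.+1%:R / 2 * gamma_int (k.+1%:R / 2) :> R.
Proof.
have [l kl] := cvg_gmoment k.
rewrite (gamma_int_cvg kl) -(gamma_int_cvg (cvg_gmoment_rec kl)); congr gamma_int.
by rewrite -(natr1 k.+2) -(natr1 k.+1); field.
Qed.

Lemma gamma_pos (x : R) : 0 < x -> gamma x = gamma_int x.
Proof. by move=> x0; rewrite /gamma x0 big_ord0 addr0 divr1. Qed.

Lemma gamma_neg (m : nat) :
  gamma (2^-1 - m%:R) = gamma_int (2^-1) / rising (2^-1 - m%:R) m :> R.
Proof.
case: m => [|m]; first by rewrite gamma_pos ?subr0 /rising ?big_ord0 ?divr1// invr_gt0.
rewrite /gamma ifF; last first.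
  by apply/negbTE; rewrite -leNgt; have := ler1n R m.+1; rewrite ltnS leq0n; lra.
(* Since m + 1/2 truncates to m, the continuation uses m + 1 factors and ends at Gamma(1/2). *)
have -> : Num.truncn (- (2^-1 - m.+1%:R : R)) = m.
  by apply: truncn_def; rewrite -(natr1 m); lra.
by rewrite subrK.
Qed.

End GammaHalfInteger.

(** * Orthogonality and norms *)

Section Orthogonality.
Variable R : realType.
Implicit Types (p q : {poly R}) (n k l : nat).

Local Notation geg n := (gegenbauer (n.+1%:R / 2 : R)).

Let half_gt0 n : 0 < n.+1%:R / 2 :> R.
Proof. by rewrite divr_gt0. Qed.

(** For alpha = (n + 1) / 2, the weight times the operator is the derivative of [circ ^+ n.+2] times
    p', so integration by parts gives a form symmetric in p and q. *)
Lemma wint_gegenbauer_op n p q :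
  wint n (q * gegenbauer_op (n.+1%:R / 2) p) = - wint n.+2 (p^`() * q^`()).
Proof.
rewrite (_ : n.+2 = (n + 2 * 1)%N); last by rewrite muln1 addn2.
rewrite -wint_weight expr1 -wintN.
apply/eqP; rewrite -subr_eq0 -wintB; apply/eqP.
rewrite -[RHS](wint_parts n (p^`() * q)); congr wint.
rewrite /gegenbauer_op derivM -!mul_polyC.
have -> : 2 * (n.+1%:R / 2) + 1 = n.+2%:R :> R by rewrite -(natr1 n.+1); field.
ring.
Qed.

(** Eigenvectors of a symmetric operator; the eigenvalues differ by a multiple of (k - l) (k + l + 2
    alpha), which is nonzero. *)
Lemma wint_gegenbauer_orth n k l : k != l -> wint n (geg n k * geg n l) = 0.
Proof.
move=> kl.
have h : wint n (geg n k * gegenbauer_op (n.+1%:R / 2) (geg n l)) =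
    wint n (geg n l * gegenbauer_op (n.+1%:R / 2) (geg n k)).
  by rewrite !wint_gegenbauer_op [X in wint n.+2 X]mulrC.
rewrite !gegenbauer_ode -!(scalerAr _ (geg n _)) !wintZ [geg n l * _]mulrC in h.
have : (k%:R - l%:R) * (k%:R + l%:R + n.+1%:R) * wint n (geg n k * geg n l) = 0 :> R.
  move: h; have -> : 2 * (n.+1%:R / 2) = n.+1%:R :> R by field.
  move: (wint _ _) => w h.
  have -> : (k%:R - l%:R) * (k%:R + l%:R + n.+1%:R) * w =
    - (l%:R * (l%:R + n.+1%:R)) * w - - (k%:R * (k%:R + n.+1%:R)) * w by ring.
  by rewrite h subrr.
move/eqP; rewrite mulf_eq0 mulf_eq0 subr_eq0 eqr_nat (negbTE kl)/=.
by rewrite -!natrD pnatr_eq0 addnS => /eqP.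
Qed.

Lemma wint_gegenbauer_low n k q : (size q <= k)%N -> wint n (geg n k * q) = 0.
Proof.
move: {2}(size q) (leqnn (size q)) => m.
elim: m q => [|m IH] q sq qk.
  by move: sq; rewrite leqn0 size_poly_eq0 => /eqP ->; rewrite mulr0 wint0.
have [qm|mq] := leqP (size q) m; first exact: IH.
have mk : (m < k)%N by exact: leq_trans mq qk.
have C0 : (geg n m)`_m != 0.
  have := size_gegenbauer m (half_gt0 n).
  move=> e; have := lead_coefE (geg n m); rewrite e /= => <-.
  by rewrite lead_coef_eq0 -size_poly_eq0 e.
(* Subtracting this multiple of C_m removes the term of degree m, and C_m is orthogonal to C_k
   because m < k. *)
set c := q`_m / (geg n m)`_m.
have -> : q = (q - c *: geg n m) + c *: geg n m by rewrite subrK.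
have sz : (size (q - c *: geg n m)%R <= m)%N.
  apply/leq_sizeP => j; rewrite coefB coefZ leq_eqVlt => /predU1P[<-|mj].
    by rewrite /c divfK// subrr.
  rewrite coef_gegenbauer_gt// mulr0 subr0 nth_default//.
  exact: leq_trans sq mj.
rewrite mulrDr wintD IH ?(leq_trans sz (ltnW mk))// -scalerAr wintZ.
by rewrite wint_gegenbauer_orth ?mulr0 ?addr0// gtn_eqF.
Qed.

(* For alpha = (n + 1) / 2 this is the classical value
   pi 2^(1 - 2 alpha) Gamma(k + 2 alpha) / (k! (k + alpha) Gamma(alpha)^2). *)
Definition gegenbauer_norm n k : R :=
  2 * pi * (k + n)`!%:R /
  (2 ^+ n * k`!%:R * (2 * k + n.+1)%:R * gamma_int (n.+1%:R / 2) ^+ 2).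

Lemma gamma_int_half_gt0 n : 0 < gamma_int (n.+1%:R / 2 : R).
Proof.
have [//] : 0 < gamma_int (n.+1%:R / 2 : R) /\ 0 < gamma_int (n.+2%:R / 2 : R).
elim: n => [|n [h1 h2]].
  by rewrite divff// gamma_int_1 gamma_int_half sqrtr_gt0 pi_gt0.
split => //; have -> : n.+3%:R / 2 = n.+1%:R / 2 + 1 :> R.
  by rewrite -(natr1 n.+2) -(natr1 n.+1); field.
by rewrite gamma_int_rec mulr_gt0.
Qed.

Lemma gamma_int_half_SS n :
  gamma_int (n.+3%:R / 2) = n.+1%:R / 2 * gamma_int (n.+1%:R / 2) :> R.
Proof.
rewrite -gamma_int_rec; congr gamma_int.
by rewrite -(natr1 n.+2) -(natr1 n.+1); field.
Qed.

(** Taking p = s in [wint_parts] gives (n + 3) I_(n+2) = (n + 2) I_n for the total masses I_n, so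
    the cases n = 0 and n = 1 determine all others. *)
Lemma wint_one n : wint n 1 = gegenbauer_norm n 0.
Proof.
have [//] : wint n 1 = gegenbauer_norm n 0 /\ wint n.+1 1 = gegenbauer_norm n.+1 0.
elim: n => [|n [h1 h2]].
  rewrite wint01 wint11 /gegenbauer_norm gamma_int_half divff// gamma_int_1.
  have -> : (0 + 0)`! = 1%N by [].
  have -> : (0 + 1)`! = 1%N by [].
  rewrite sqr_sqrtr ?pi_ge0//; have := pi_gt0 R => pi0; split; last by field.
  by rewrite muln0 add0n expr0 !mul1r mulr1 mulfK// gt_eqF.
split => //; have := wint_parts n ('X : {poly R}).
rewrite derivX mulr1 -expr2.
have -> : (1 - 'X^2) - n.+2%:R *: 'X^2 =
    n.+3%:R *: ((1 - 'X^2) ^+ 1 * 1) - n.+2%:R *: 1 :> {poly R}.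
  by rewrite expr1 mulr1 -!mul_polyC -(natr1 n.+2) !rmorphD/= !rmorph1; ring.
rewrite wintB !wintZ wint_weight muln1 addn2 h1 => /eqP; rewrite subr_eq0 => /eqP h.
have n3 : n.+3%:R != 0 :> R by rewrite pnatr_eq0.
apply: (mulfI n3); rewrite h /gegenbauer_norm gamma_int_half_SS !add0n fact0.
rewrite !factS !natrM !(exprS 2).
have n1 : n.+1%:R != 0 :> R by rewrite pnatr_eq0.
have g0 := gt_eqF (gamma_int_half_gt0 n).
have n2 : (0 : R) <= n%:R by [].
field; rewrite ?g0 /= expf_neq0 ?pnatr_eq0//= !gt_eqF//=; lra.
Qed.

(* Integrating C_(k+1)' ^ 2 against (1 - s^2) times the weight lowers the degree
   and raises alpha by 1. *)
Lemma wint_gegenbauer_sqr n k : wint n (geg n k ^+ 2) = gegenbauer_norm n k.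
Proof.
elim: k n => [|k IH] n; first by rewrite gegenbauer0 expr1n wint_one.
have := wint_gegenbauer_op n (geg n k.+1) (geg n k.+1).
rewrite gegenbauer_ode -scalerAr wintZ deriv_gegenbauer.
have -> : n.+1%:R / 2 + 1 = n.+3%:R / 2 :> R.
  by rewrite -(natr1 n.+2) -(natr1 n.+1); field.
set c := 2 * (n.+1%:R / 2).
have -> : (c *: geg n.+2 k) * (c *: geg n.+2 k) = (c * c) *: geg n.+2 k ^+ 2.
  by rewrite -scalerAl -scalerAr scalerA expr2.
rewrite -expr2 wintZ IH mulNr => /oppr_inj; rewrite /c.
have -> : 2 * (n.+1%:R / 2) = n.+1%:R :> R by field.
have k0 : k.+1%:R * (k.+1%:R + n.+1%:R) != 0 :> R.
  by rewrite mulf_neq0 ?pnatr_eq0// -natrD pnatr_eq0.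
move=> h; apply: (mulfI k0); rewrite h /gegenbauer_norm gamma_int_half_SS.
rewrite addSnnS addnS !factS !natrM !exprS.
have -> : (2 * k.+1 + n.+1 = 2 * k + n.+3)%N by lia.
have n1 : n.+1%:R != 0 :> R by rewrite pnatr_eq0.
have g0 := gt_eqF (gamma_int_half_gt0 n).
have s0 := gt_eqF (ltr0Sn R (2 * k + n.+2)).
have f0 := fact_neq0 R k.
rewrite -[(2 * k + n.+2).+1]addnS in s0.
have k1 : (0 : R) <= k%:R by [].
have n2 : (0 : R) <= n%:R by [].
field; rewrite ?n1 ?g0 ?s0 ?f0 /= expf_neq0 ?pnatr_eq0//= !gt_eqF//=; lra.
Qed.

End Orthogonality.

(** * Gauss quadrature *)

Section GaussQuadrature.
Variables (R : realType) (Q : nat) (u : 'I_Q -> R).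
Hypothesis u_inj : injective u.
Implicit Types (p q : {poly R}) (n : nat) (k : 'I_Q).

Definition lagrange_basis k : {poly R} :=
  \prod_(i < Q | i != k) ((u k - u i)^-1 *: ('X - (u i)%:P)).

Lemma size_lagrange_basis k : (size (lagrange_basis k) <= Q)%N.
Proof.
have c : #|[pred i | i != k]| = Q.-1 by rewrite cardC1 card_ord.
have Q0 : (0 < Q)%N by exact: leq_ltn_trans (ltn_ord k).
apply: leq_trans (size_poly_prod_leq _ _) _; rewrite c.
have : (\sum_(i < Q | i != k) size ((u k - u i)^-1 *: ('X - (u i)%:P))%R
    <= \sum_(i < Q | i != k) 2)%N.
  apply: leq_sum => i ik; rewrite (leq_trans (size_scale_leq _ _))//.
  by rewrite size_XsubC.
rewrite sum_nat_const c; move: (bigop _ _ _) => S; lia.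
Qed.

Lemma horner_lagrange_basis k k' : (lagrange_basis k).[u k'] = (k == k')%:R.
Proof.
rewrite horner_prod; case: eqVneq => [<-|kk'].
  rewrite big1// => i ik; rewrite !hornerE mulVf// subr_eq0.
  by rewrite (inj_eq u_inj) eq_sym.
by rewrite (bigD1 k') 1?eq_sym//= !hornerE subrr mulr0 mul0r.
Qed.

Lemma poly_uniq_nodes p : (size p <= Q)%N -> (forall k, p.[u k] = 0) -> p = 0.
Proof.
move=> sp pu; apply: (@roots_geq_poly_eq0 _ _ (codom u)).
- by apply/allP => x /codomP[k ->]; apply/rootP.
- by rewrite map_inj_uniq ?enum_uniq.
- by rewrite size_codom card_ord.
Qed.

Lemma lagrange_interpolation p : (size p <= Q)%N ->
  p = \sum_k p.[u k] *: lagrange_basis k.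
Proof.
move=> sp; apply/eqP; rewrite -subr_eq0; apply/eqP/poly_uniq_nodes.
  rewrite (leq_trans (size_polyD _ _))// geq_max sp size_polyN.
  apply: (leq_trans (size_sum _ _ _)); apply/bigmax_leqP => k _.
  exact: leq_trans (size_scale_leq _ _) (size_lagrange_basis k).
move=> k; rewrite !hornerE horner_sum (bigD1 k)//= big1 => [|i ik].
  by rewrite hornerZ horner_lagrange_basis eqxx mulr1 addr0 subrr.
by rewrite hornerZ horner_lagrange_basis (negbTE ik) mulr0.
Qed.

(** Divide p by C_Q. The multiple of C_Q integrates to 0, its quotient having degree below Q, and
    vanishes at the nodes; the remainder equals its Lagrange interpolant. *)
Lemma gauss_quadrature n p :
  (forall k, root (gegenbauer (n.+1%:R / 2) Q) (u k)) -> (size p <= 2 * Q)%N ->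
  wint n p = \sum_k wint n (lagrange_basis k) * p.[u k].
Proof.
set C := gegenbauer _ _ => Cu sp.
have sC : size C = Q.+1 by rewrite size_gegenbauer// divr_gt0.
have C0 : C != 0 by rewrite -size_poly_eq0 sC.
have sm : (size (p %% C)%R <= Q)%N by rewrite -ltnS -sC ltn_modp.
have sd : (size (p %/ C)%R <= Q)%N by rewrite size_divp// sC /= leq_subLR addnn -mul2n.
have -> : wint n p = wint n (p %% C).
  rewrite [in LHS](divp_eq p C) wintD mulrC wint_gegenbauer_low ?add0r//.
have pE k : p.[u k] = (p %% C).[u k].
  by rewrite [in LHS](divp_eq p C) hornerD hornerM (rootP (Cu k)) mulr0 add0r.
rewrite [in LHS](lagrange_interpolation sm) wint_sum.
by apply: eq_bigr => k _; rewrite wintZ mulrC pE.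
Qed.

End GaussQuadrature.

(** * The colatitude factors of the harmonics *)

Section HarmonicFactor.
Variable R : realType.
Implicit Types (d j n : nat) (a b : int) (x s : R).

(* The factor of the harmonic in theta^(j), with x = cos theta, s = sin theta. *)
Definition harm_factor d j a b x s : R :=
  hnorm R d a b j * (gegenbauer (b%:~R + (d - j)%:R / 2) `|(a - b)%R|%N).[x] * s ^ b.

(** Two factors sin^b raise the weight index from n to n + 2 b, which is the index matching the
    parameter b + (d - j) / 2. *)
Lemma hnorm_nat d j n (a b : nat) : (d - j = n.+1)%N -> (b <= a)%N ->
  hnorm R d a b j ^+ 2 * gegenbauer_norm R (n + 2 * b) (a - b) = 1.
Proof.
move=> dj ba; rewrite /hnorm dj.
have -> : `|(a%:Z - b%:Z)%R|%N = (a - b)%N by lia.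
have -> : `|(a%:Z + b%:Z + n.+1%:Z - 1)%R|%N = (a + b + n)%N by lia.
have -> : (2 * a%:Z + n.+1%:Z)%:~R = (2 * a + n.+1)%:R :> R.
  have -> : 2 * a%:Z + n.+1%:Z = (2 * a + n.+1)%N%:Z by lia.
  by rewrite -pmulrn.
have -> : (2%:R : R) ^ (2 * b%:Z + n.+1%:Z - 2) = 2 ^+ (n + 2 * b) / 2.
  have -> : 2 * b%:Z + n.+1%:Z - 2 = (n + 2 * b)%N%:Z - 1 by lia.
  by rewrite expfzDr// -exprnP exprN1.
have -> : b%:~R + n.+1%:R / 2 = (n + 2 * b).+1%:R / 2 :> R.
  by rewrite -addSn natrD natrM -pmulrn; field.
rewrite gamma_pos ?divr_gt0//.
have pi0 := pi_gt0 R; have g0 := gamma_int_half_gt0 R (n + 2 * b).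
have f1 := ltr0n R (a - b)`!; have f2 := ltr0n R (a + b + n)`!.
rewrite fact_gt0 in f1; rewrite fact_gt0 in f2.
have e2 : (0 : R) < 2 ^+ (n + 2 * b) by rewrite exprn_gt0.
rewrite sqr_sqrtr; last first.
  by rewrite divr_ge0 ?mulr_ge0 ?exprn_ge0 ?ltW// divr_gt0.
rewrite /gegenbauer_norm.
have -> : (a - b + (n + 2 * b) = a + b + n)%N by lia.
have -> : (2 * (a - b) + (n + 2 * b).+1 = 2 * a + n.+1)%N by lia.
have s0 := ltr0Sn R (2 * a + n); rewrite -addnS in s0.
move: e2 s0 f1 f2 g0 pi0.
move: (2 ^+ (n + 2 * b)) (2 * a + n.+1)%:R (a - b)`!%:R (a + b + n)`!%:R.
move: (gamma_int _) pi => G p E S F1 F2 *.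
by field; rewrite !gt_eqF.
Qed.

Lemma gamma_int_rising (m : nat) :
  gamma_int ((2 * m).+1%:R / 2) = rising 2^-1 m * gamma_int 2^-1 :> R.
Proof.
elim: m => [|m IH]; first by rewrite /rising big_ord0 muln0 !mul1r.
have -> : (2 * m.+1).+1 = (2 * m).+3 by lia.
by rewrite gamma_int_half_SS IH risingSr -(natr1 (2 * m)) natrM; field.
Qed.

(** The second factor is the constant of [gegenbauer_neg_order]. Being positive it goes under the
    square root, where Gamma occurs squared and the sign (-1)^m disappears. *)
Lemma hnorm_neg d j (a m : nat) : (d - j = 1)%N -> (m <= a)%N ->
  hnorm R d a (- m%:Z) j *
    (2 ^+ (2 * m) * rising 2^-1 m ^+ 2 * (a - m)`!%:R / (a + m)`!%:R) =
  hnorm R d a m j.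
Proof.
move=> dj ma; set c := _ / _.
have f1 := ltr0n R (a - m)`!; have f2 := ltr0n R (a + m)`!.
rewrite fact_gt0 in f1; rewrite fact_gt0 in f2.
have r0 : 0 < rising (2^-1 : R) m by rewrite rising_gt0// invr_gt0.
have e2 : (0 : R) < 2 ^+ (2 * m) by rewrite exprn_gt0.
have c0 : 0 < c by rewrite divr_gt0// !mulr_gt0// exprn_gt0.
have -> : c = Num.sqrt (c ^+ 2) by rewrite sqrtr_sqr gtr0_norm.
rewrite mulrC -sqrtrM ?exprn_ge0 ?(ltW c0)//; congr Num.sqrt; rewrite dj.
have -> : `|(a%:Z - m%:Z)%R|%N = (a - m)%N by lia.
have -> : `|(a%:Z - - m%:Z)%R|%N = (a + m)%N by lia.
have -> : `|(a%:Z + m%:Z + 1%:Z - 1)%R|%N = (a + m)%N by lia.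
have -> : `|(a%:Z + - m%:Z + 1%:Z - 1)%R|%N = (a - m)%N by lia.
have -> : (2%:R : R) ^ (2 * - m%:Z + 1%:Z - 2) = (2 ^+ (2 * m))^-1 / 2.
  have -> : 2 * - m%:Z + 1%:Z - 2 = - (2 * m)%N%:Z - 1 by lia.
  by rewrite expfzDr// exprN1 -exprnN.
have -> : (2%:R : R) ^ (2 * m%:Z + 1%:Z - 2) = 2 ^+ (2 * m) / 2.
  have -> : 2 * m%:Z + 1%:Z - 2 = (2 * m)%N%:Z - 1 by lia.
  by rewrite expfzDr// -exprnP exprN1.
have -> : (- m%:Z)%:~R + 1%:R / 2 = 2^-1 - m%:R :> R.
  by rewrite mulrNz -pmulrn mul1r addrC.
have -> : (m%:Z)%:~R + 1%:R / 2 = (2 * m).+1%:R / 2 :> R.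
  by rewrite -(natr1 (2 * m)) natrM -pmulrn; field.
rewrite gamma_neg gamma_pos ?divr_gt0// gamma_int_rising rising_half /c {c c0}.
have pi0 := pi_gt0 R.
have s0 : ((-1) ^+ m : R) ^+ 2 = 1 by rewrite sqrr_sign.
have -> : (gamma_int 2^-1 / ((-1) ^+ m * rising 2^-1 m)) ^+ 2 =
    (gamma_int 2^-1 / rising 2^-1 m) ^+ 2 :> R.
  by rewrite !expr_div_n exprMn s0 mul1r.
move: e2 r0 f1 f2 pi0; clear.
move: (2 ^+ (2 * m)) (rising _ _) (a - m)`!%:R (a + m)`!%:R.
move: (gamma_int _) pi (_%:~R) => G p S E r F1 F2 *.
by field; rewrite !gt_eqF.
Qed.

(** The polynomial identity brings a factor (1 - x^2)^m = s^(2 m), which turns s^(-m) into s^m as s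
    is nonzero. *)
Lemma harm_factor_neg d j (a m : nat) x s :
  (d - j = 1)%N -> (m <= a)%N -> s != 0 -> s ^+ 2 = 1 - x ^+ 2 ->
  harm_factor d j a (- m%:Z) x s = harm_factor d j a m x s.
Proof.
move=> dj ma s0 s2; rewrite /harm_factor dj.
have -> : `|(a%:Z - m%:Z)%R|%N = (a - m)%N by lia.
have -> : `|(a%:Z - - m%:Z)%R|%N = (a + m)%N by lia.
have -> : (- m%:Z)%:~R + 1%:R / 2 = 2^-1 - m%:R :> R.
  by rewrite mulrNz -pmulrn mul1r addrC.
have -> : (m%:Z)%:~R + 1%:R / 2 = 2^-1 + m%:R :> R.
  by rewrite -pmulrn mul1r addrC.
rewrite gegenbauer_neg_order// hornerZ hornerM horner_exp mulrA hnorm_neg//.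
rewrite -exprnN -exprnP !hornerE -s2 -exprM mul2n -addnn exprD.
by rewrite /=; field; rewrite expf_neq0.
Qed.

End HarmonicFactor.

(** * The discrete scalar product *)

Section RootsOfUnity.
Variable R : realType.
Implicit Types x y : R.

Lemma expiD x y : expi (x + y) = expi x * expi y.
Proof. by rewrite /expi cosD sinD; congr Complex; rewrite addrC. Qed.

Lemma expi0 : expi (0 : R) = 1.
Proof. by rewrite /expi cos0 sin0. Qed.

Lemma conj_expi x : ((expi x)^*)%C = expi (- x).
Proof. by rewrite /expi cosN sinN. Qed.

Lemma expi_natmul x (n : nat) : expi (n%:R * x) = expi x ^+ n.
Proof.
elim: n => [|n IH]; first by rewrite mul0r expi0.
by rewrite -natr1 mulrDl mul1r expiD IH exprSr.
Qed.

Lemma expi_2pi : expi (2 * pi : R) = 1.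
Proof.
have -> : 2 * pi = pi + pi :> R by ring.
rewrite expiD /expi cospi sinpi; apply/eqP; rewrite eq_complex /=.
by apply/andP; split; apply/eqP; ring.
Qed.

Lemma expi_neq1 x : 0 < x < 2 * pi -> expi x != 1.
Proof.
move=> /andP[x0 x1]; rewrite eq_complex /= negb_and; apply/orP; left.
have -> : x = x / 2 + x / 2 by field.
rewrite cosD -!expr2 cos2sin2.
have s0 : 0 < sin (x / 2) by rewrite sin_gt0_pi// divr_gt0//= ltr_pdivrMr// mulrC.
apply/eqP => h; suff : sin (x / 2) ^+ 2 = 0 by apply/eqP; rewrite gt_eqF// exprn_gt0.
lra.
Qed.

(** A geometric sum whose ratio is a root of unity of order dividing 2 M; the bound on [mu] keeps
    the ratio away from 1 unless [mu] is 0. *)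
Lemma sum_expi (M : nat) (mu : int) : (`|mu| < 2 * M)%N ->
  \sum_(p < 2 * M) expi (mu%:~R * (p%:R * pi / M%:R)) =
  (if mu == 0 then (2 * M)%:R else 0) :> R[i].
Proof.
move=> muM; have M0 : (0 < M)%N by lia.
have M0' : (M%:R : R) != 0 by rewrite pnatr_eq0; lia.
case: eqP => [->|/eqP mu0].
  under eq_bigr do rewrite mul0r expi0.
  by rewrite sumr_const card_ord.
set z := expi (mu%:~R * (pi / M%:R) : R).
have zp p : expi (mu%:~R * (p%:R * pi / M%:R) : R) = z ^+ p.
  by rewrite -expi_natmul; congr expi; ring.
under eq_bigr do rewrite zp.
have n_gt0 (n : nat) : (0 < n < 2 * M)%N -> expi (n%:R * (pi / M%:R) : R) != 1.
  move=> /andP[n0 nM]; apply: expi_neq1.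
  rewrite mulr_gt0 ?ltr0n ?divr_gt0 ?pi_gt0 ?ltr0n//= mulrA ltr_pdivrMr ?ltr0n//.
  by rewrite mulrAC -natrM ltr_pM2r ?pi_gt0// ltr_nat.
have nV (n : nat) : expi (n%:R * (2 * pi) : R) = 1 by rewrite expi_natmul expi_2pi expr1n.
have [z1 zM] : z != 1 /\ z ^+ (2 * M) = 1.
  rewrite -zp natrM /z.
  have -> : 2 * M%:R * pi / M%:R = 2 * pi :> R by field.
  case: mu muM mu0 {z zp} => n nM n0.
    by rewrite -pmulrn; split; [apply: n_gt0; lia|exact: nV].
  (* Conjugation reduces a negative [mu] to a positive one. *)
  rewrite NegzE mulrNz -pmulrn !mulNr -!conj_expi nV; split; last exact: conjc1.
  rewrite -(inj_eq (can_inj (@conjcK R))) conjcK [X in _ != X]conjc1.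
  by apply: n_gt0; lia.
apply/eqP; have : (z - 1) * \sum_(p < 2 * M) z ^+ p = 0.
  by rewrite -subrX1 zM subrr.
by move/eqP; rewrite mulf_eq0 subr_eq0 (negbTE z1).
Qed.

End RootsOfUnity.

(** * Quadrature nodes and orthonormality in a single colatitude *)

Section Nodes.
Variables (R : realType) (d Q : nat) (t : nat -> 'I_Q -> R).
Hypothesis ht : gegenbauer_nodes d t.

Lemma gegenbauer_node_inj j : (1 <= j < d)%N -> injective (t j).
Proof.
move=> jd k k' e; apply/val_inj/eqP; rewrite eqn_leq; apply/andP.
have [lt_t _] := ht jd.
by split; rewrite leqNgt; apply/negP => /lt_t; rewrite e ltxx.
Qed.

Lemma gegenbauer_node_root j k : (1 <= j < d)%N ->
  root (gegenbauer ((d - j)%:R / 2) Q) (t j k).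
Proof. by move=> jd; have [_ rt] := ht jd; apply/rt; exists k. Qed.

Lemma gegenbauer_node_bound j k : (1 <= j < d)%N -> -1 < t j k < 1.
Proof.
move=> jd; apply: root_gegenbauer_lt1 (gegenbauer_node_root k jd).
by rewrite divr_gt0// ltr0n; lia.
Qed.

Lemma cos_node j k : (1 <= j < d)%N -> cos (node_colat t j k) = t j k.
Proof.
move=> /(gegenbauer_node_bound k)/andP[t1 t2]; rewrite acosK// in_itv/=.
by rewrite !ltW.
Qed.

Lemma sin_node j k : (1 <= j < d)%N -> sin (node_colat t j k) = circ (t j k).
Proof. by move=> /(gegenbauer_node_bound k)/andP[t1 t2]; rewrite sin_acos// !ltW. Qed.

Lemma circ_node_neq0 j k : (1 <= j < d)%N -> circ (t j k) != 0.
Proof.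
move=> /(gegenbauer_node_bound k)/andP[t1 t2]; rewrite gt_eqF// sqrtr_gt0; nra.
Qed.

Lemma gauss_weightE j n k : (d - j = n.+1)%N ->
  gauss_weight d t j k = wint n (lagrange_basis (t j) k).
Proof.
move=> dj; apply: eq_Rintegral => s; rewrite inE/= in_itv/= => /andP[s1 s2].
congr (_ * _); last first.
  by rewrite horner_prod; apply: eq_bigr => i _; rewrite !hornerE mulrC.
rewrite dj subn1/= mulrC powRrM powR12_sqrt; last by nra.
by rewrite powR_mulrn// sqrtr_ge0.
Qed.

(** For b >= 0 the product of the two factors is (1 - t^2)^b times two Gegenbauer polynomials, of
    total degree at most a + a' < 2 Q, so the quadrature is exact on it. *)
Lemma gauss_harm_factor j (b : int) (a a' : nat) : (1 <= j < d)%N ->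
  (`|b| <= a)%N -> (`|b| <= a')%N -> 0 <= b \/ (d - j = 1)%N -> (a + a' < 2 * Q)%N ->
  \sum_k gauss_weight d t j k * (harm_factor d j a b (t j k) (circ (t j k)) *
     harm_factor d j a' b (t j k) (circ (t j k))) = (a == a')%:R.
Proof.
(* A negative b is possible only when d - j = 1, where [harm_factor_neg] replaces it by its absolute
   value. *)
move=> jd; wlog : b / exists B : nat, b = B.
  move=> W; case: b => [B|B]; first by apply: W; exists B.
  move=> ba ba' [//|dj] aa'.
  rewrite -[RHS](W B.+1)//; [|by exists B.+1|by right].
  apply: eq_bigr => k _.
  have c0 := circ_node_neq0 k jd.
  have c2 : circ (t j k) ^+ 2 = 1 - t j k ^+ 2.
    by have /andP[t1 t2] := gegenbauer_node_bound k jd; rewrite circ_sqr// in_itv/= !ltW.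
  by rewrite NegzE !harm_factor_neg.
move=> [B ->] /= Ba Ba' _ aa'.
have [n dj] : exists n, (d - j = n.+1)%N by exists (d - j).-1; lia.
pose g (a : nat) := gegenbauer (B%:~R + (d - j)%:R / 2 : R) (a - B).
have gE (a0 : nat) : g a0 = gegenbauer ((n + 2 * B).+1%:R / 2) (a0 - B).
  by rewrite /g dj -addSn natrD natrM -pmulrn; congr gegenbauer; field.
have absB (a0 : nat) : (B <= a0)%N -> `|(a0%:Z - B%:Z)%R|%N = (a0 - B)%N by lia.
have sg : (size (g a * g a')%R <= (a - B + (a' - B)).+1)%N.
  apply: (leq_trans (size_polyMleq _ _)).
  have := size_gegenbauer_le (B%:~R + (d - j)%:R / 2 : R) (a - B).
  have := size_gegenbauer_le (B%:~R + (d - j)%:R / 2 : R) (a' - B).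
  rewrite -/(g a) -/(g a'); move: (size _) (size _) => x y; lia.
have [sP _] := coef_weight_top B sg.
transitivity (hnorm R d a B j * hnorm R d a' B j *
    wint n ((1 - 'X^2) ^+ B * (g a * g a'))).
  rewrite (@gauss_quadrature _ _ _ (gegenbauer_node_inj jd)); last first.
  - apply: (leq_trans sP); lia.
  - by move=> k; rewrite -dj; exact: gegenbauer_node_root.
  rewrite mulr_sumr; apply: eq_bigr => k _; rewrite (gauss_weightE _ dj).
  have c2 : circ (t j k) ^+ 2 = 1 - t j k ^+ 2.
    by have /andP[t1 t2] := gegenbauer_node_bound k jd; rewrite circ_sqr// in_itv/= !ltW.
  rewrite /harm_factor !absB// -!/(g _) hornerM horner_exp !hornerE -c2.
  by rewrite -exprM -exprnP mul2n -addnn exprD /=; ring.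
rewrite wint_weight !gE; case: eqVneq => [<-|aa].
  by rewrite -[RHS](hnorm_nat R dj Ba) -wint_gegenbauer_sqr !expr2.
rewrite wint_gegenbauer_orth ?mulr0//; apply/eqP => e; move/eqP: aa; lia.
Qed.

End Nodes.

(** * Multi-indices of the harmonics *)

Section HarmonicIndex.
Variables (d : nat) (hd : (2 <= d)%N).
Implicit Types (l : nat) (m : (d.-1).-tuple int).

Lemma mcoord_last_le l m j : harm_index d l m -> (j <= d.-2)%N ->
  mcoord l m d.-2 <= mcoord l m j.
Proof.
move=> [mono _ _] jd; have -> : j = (d.-2 - (d.-2 - j))%N by lia.
elim: (d.-2 - j)%N => [|i IH]; first by rewrite subn0.
have [di|id] := leqP d.-2 i; first by have -> : (d.-2 - i.+1 = d.-2 - i)%N by lia.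
apply: (le_trans IH); have -> : (d.-2 - i.+1 = (d.-2 - i).-1)%N by lia.
by apply: mono; lia.
Qed.

Lemma mcoord_ge0 l m j : harm_index d l m -> (j < d.-1)%N -> 0 <= mcoord l m j.
Proof.
move=> h jd; have [_ h0 _] := h; apply: (le_trans h0); apply: mcoord_last_le => //; lia.
Qed.

(** Absolute values cover the last entry, the only one that may be negative. *)
Lemma mcoord_step l m j : harm_index d l m -> (j < d.-1)%N ->
  (`|mcoord l m j.+1| <= `|mcoord l m j|)%N.
Proof.
move=> h jd; have j0 := mcoord_ge0 h jd; have [mono _ last] := h.
have [jd2|jd2] := ltnP j.+1 d.-1.
  have := mcoord_ge0 h jd2; have := mono j.+1; rewrite jd2 => /(_ isT) /=; lia.
have e : j = d.-2 by lia.
have e' : j.+1 = d.-1 by lia.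
move: last; rewrite e' e; move: (mcoord _ _ _) (mcoord _ _ _) => x y; lia.
Qed.

Lemma mcoord_le l m j : harm_index d l m -> (j <= d.-1)%N ->
  (`|mcoord l m j| <= l)%N.
Proof.
move=> h; elim: j => [|j IH] jd; first by rewrite /mcoord.
exact: leq_trans (mcoord_step h jd) (IH (ltnW jd)).
Qed.

(** Needed to rewrite the sums over [harm_index] as sums over finite sequences. All entries lie in
    [-l, l], and a shift by l encodes them as ordinals. *)
Lemma finite_harm_index l : finite_set (harm_index d l).
Proof.
pose f (g : {ffun 'I_d.-1 -> 'I_(2 * l).+1}) : (d.-1).-tuple int :=
  [tuple (g i : nat)%:Z - l%:Z | i < d.-1].
apply: (@sub_finite_set _ _ [set f g | g in [set: {ffun 'I_d.-1 -> 'I_(2 * l).+1}]]).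
  move=> m h; exists [ffun i => inord `|(tnth m i + l%:Z)%R|%N] => //.
  apply/eq_from_tnth => i; rewrite tnth_mktuple ffunE.
  have := @mcoord_le l m i.+1 h (ltn_ord i).
  rewrite /mcoord /= -(tnth_nth 0) => hi.
  move: (tnth m i) hi => z hi; rewrite inordK; lia.
exact: finite_image.
Qed.

Lemma mcoord_inj l l' m m' :
  (forall j, (j <= d.-1)%N -> mcoord l m j = mcoord l' m' j) -> l = l' /\ m = m'.
Proof.
move=> h; split; first by have [] := h 0%N isT.
apply/eq_from_tnth => i; have := h i.+1 (ltn_ord i).
by rewrite /mcoord /= -!(tnth_nth 0).
Qed.

End HarmonicIndex.

(** * Discrete orthonormality of the harmonics *)

Section DiscreteOrthonormality.
Variables (R : realType) (d : nat) (hd : (2 <= d)%N) (Q M : nat).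
Variable t : nat -> 'I_Q -> R.
Hypothesis ht : gegenbauer_nodes d t.
Hypothesis M0 : (0 < M)%N.
Implicit Types (l : nat) (m : (d.-1).-tuple int) (k : {ffun 'I_d.-1 -> 'I_Q}).
Implicit Types (p : 'I_(2 * M)) (i : 'I_d.-1).

Let hi i : (1 <= i.+1 < d)%N.
Proof. by have := ltn_ord i; lia. Qed.

Lemma colat_sample_point k p i :
  colat (sample_point t k p).1 i.+1 = node_colat t i.+1 (k i).
Proof.
rewrite /colat; have := tnth_nth 0 (sample_point t k p).1 i.
by rewrite tnth_mktuple => ->.
Qed.

Lemma sphere_coords_sample_point k p : sphere_coords R d (sample_point t k p).
Proof.
split => [j jd|].
  have [i ->] : exists i : 'I_d.-1, j = i.+1.
    have jd' : (j.-1 < d.-1)%N by lia.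
    by exists (Ordinal jd') => /=; lia.
  rewrite (colat_sample_point k p).
  have /andP[t1 t2] := gegenbauer_node_bound ht (k i) (hi i).
  by rewrite acos_ge0 ?acos_lepi ?ltW.
have pi0 := pi_gt0 R; rewrite /=.
rewrite divr_ge0 ?mulr_ge0 ?pi_ge0//= ltr_pdivrMr ?ltr0n// mulrAC.
by rewrite -natrM ltr_pM2r// ltr_nat.
Qed.

Definition node_factor l m (i : nat) (x : 'I_Q) : R :=
  harm_factor d i.+1 (mcoord l m i) (mcoord l m i.+1) (t i.+1 x) (circ (t i.+1 x)).

Lemma hharm_sample_point l m k p : hharm l m (sample_point t k p) =
  ((Num.sqrt (2 * pi))^-1 * \prod_(i < d.-1) node_factor l m i (k i))%:C%C *
  expi ((mcoord l m d.-1)%:~R * (p%:R * pi / M%:R)).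
Proof.
rewrite /hharm big_add1 big_mkord; congr ((_ * _)%:C%C * _).
apply: eq_bigr => i _; rewrite (colat_sample_point k p).
by rewrite (cos_node ht)// (sin_node ht).
Qed.

(** The Jacobian cancels the sine powers in the denominators of [colat_weight], leaving plain Gauss
    weights. *)
Lemma sample_weight_jacobian k p :
  sample_weight M t k * Defs.jacobian (sample_point t k p).1 =
  (\prod_(i < d.-1) gauss_weight d t i.+1 (k i)) * (pi / M%:R).
Proof.
rewrite /sample_weight /Defs.jacobian /azimuth_weight big_add1 big_mkord.
rewrite mulrAC -big_split/=; congr (_ * _).
apply: eq_bigr => i _; rewrite (colat_sample_point k p).
rewrite /colat_weight divfK// expf_neq0// (sin_node ht)//.
apply: (circ_node_neq0 ht); exact: hi.
Qed.

Lemma sum_node_factor l l' m m' : harm_index d l m -> harm_index d l' m' ->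
  mcoord l m d.-1 = mcoord l' m' d.-1 -> (l + l' < 2 * Q)%N ->
  \sum_(k : {ffun 'I_d.-1 -> 'I_Q}) \prod_(i < d.-1) (gauss_weight d t i.+1 (k i) *
    (node_factor l' m' i (k i) * node_factor l m i (k i))) =
  ((l == l') && (m == m'))%:R.
Proof.
move=> h h' last ll.
rewrite -(bigA_distr_bigA (fun i x => gauss_weight d t i.+1 x *
    (node_factor l' m' i x * node_factor l m i x))) /=.
have fac (i : 'I_d.-1) : mcoord l m i.+1 = mcoord l' m' i.+1 ->
    \sum_(x < Q) gauss_weight d t i.+1 x *
      (node_factor l' m' i x * node_factor l m i x) =
    (mcoord l m i == mcoord l' m' i)%:R.
  move=> e; have a0 := mcoord_ge0 hd h (ltn_ord i).
  have a0' := mcoord_ge0 hd h' (ltn_ord i).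
  have s := mcoord_step hd h (ltn_ord i); have s' := mcoord_step hd h' (ltn_ord i).
  have b := mcoord_le hd h (ltnW (ltn_ord i)).
  have b' := mcoord_le hd h' (ltnW (ltn_ord i)).
  (* A negative entry can occur only in the factor of the last colatitude. *)
  have last_or : 0 <= mcoord l m i.+1 \/ (d - i.+1 = 1)%N.
    have [id|id] := ltnP i.+1 d.-1; first by left; exact (mcoord_ge0 hd h id).
    by right; have := ltn_ord i; lia.
  rewrite /node_factor -e in s' *.
  move: (mcoord l m i) (mcoord l' m' i) a0 a0' s s' b b' => [a|//] [a'|//] _ _ /= s s' b b'.
  rewrite (gauss_harm_factor ht (hi i))//; last by lia.
  by rewrite eq_sym.
have [/forallP all_eq|] := boolP [forall i : 'I_d.-1, mcoord l m i == mcoord l' m' i].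
  have eqs j : (j <= d.-1)%N -> mcoord l m j = mcoord l' m' j.
    by rewrite leq_eqVlt => /predU1P[->//|jd]; have /eqP := all_eq (Ordinal jd).
  rewrite big1 => [|i _]; last first.
    by rewrite (fac i (eqs i.+1 (ltn_ord i))) (eqs i (ltnW (ltn_ord i))) eqxx.
  by have [-> ->] := mcoord_inj eqs; rewrite !eqxx.
rewrite negb_forall => /existsP[i0 i0P].
case: (@arg_maxnP _ i0 (fun i : 'I_d.-1 => mcoord l m i != mcoord l' m' i)
  (fun i => i : nat) i0P) => i iP imax.
(* The entries at i + 1 agree, by the maximality of i or, when i + 1 = d - 1, by [last]; hence the
   factor at i is zero. *)
rewrite (bigD1 i)//= fac ?(negbTE iP) ?mul0r; last first.
  have [id|id] := ltnP i.+1 d.-1; last first.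
    by have -> : i.+1 = d.-1 by have := ltn_ord i; lia.
  apply/eqP/negPn/negP => ne; have := imax (Ordinal id) ne.
  by rewrite /= ltnn.
case: eqP => [el|//]; case: eqP => [em|//].
by move: iP; rewrite el em eqxx.
Qed.

Lemma discrete_orthonormal l l' m m' :
  harm_index d l m -> harm_index d l' m' ->
  (l + l' < 2 * Q)%N -> (l + l' < 2 * M)%N ->
  \sum_(k : {ffun 'I_d.-1 -> 'I_Q}) \sum_(p < 2 * M)
    (sample_weight M t k)%:C%C * hharm l' m' (sample_point t k p)
    * ((hharm l m (sample_point t k p))^*)%C * (Defs.jacobian (sample_point t k p).1)%:C%C
  = ((l == l') && (m == m'))%:R.
Proof.
move=> h h' lQ lM; set mu := mcoord l' m' d.-1 - mcoord l m d.-1.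
have pi0 := pi_gt0 R.
have M0' : (M%:R : R) != 0 by rewrite pnatr_eq0 -lt0n.
have cM (a b : R[i]) : ((a * b)^*)%C = (a^*)%C * (b^*)%C by exact: rmorphM.
(* Separation of colatitudes and azimuth. The constant 1 / (2 M) is the azimuthal weight pi / M
   times the normalisation 1 / (2 pi) of the two harmonics. *)
have term k p : (sample_weight M t k)%:C%C * hharm l' m' (sample_point t k p)
    * ((hharm l m (sample_point t k p))^*)%C * (Defs.jacobian (sample_point t k p).1)%:C%C =
  (\prod_(i < d.-1) (gauss_weight d t i.+1 (k i) *
    (node_factor l' m' i (k i) * node_factor l m i (k i))))%:C%C *
  (((2 * M)%:R^-1 : R)%:C%C * expi (mu%:~R * (p%:R * pi / M%:R))).
  have -> : \prod_(i < d.-1) (gauss_weight d t i.+1 (k i) *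
      (node_factor l' m' i (k i) * node_factor l m i (k i))) =
    \prod_(i < d.-1) gauss_weight d t i.+1 (k i) *
      (\prod_(i < d.-1) node_factor l' m' i (k i) *
       \prod_(i < d.-1) node_factor l m i (k i)) by rewrite -!big_split.
  rewrite !hharm_sample_point cM conjc_real conj_expi.
  set X := _^-1 * \prod_(_ < _) node_factor l' _ _ _.
  set Y := _^-1 * \prod_(_ < _) node_factor l _ _ _.
  transitivity ((sample_weight M t k * Defs.jacobian (sample_point t k p).1 * (X * Y))%:C%C *
      (expi ((mcoord l' m' d.-1)%:~R * (p%:R * pi / M%:R)) *
       expi (- ((mcoord l m d.-1)%:~R * (p%:R * pi / M%:R))))).
    by rewrite !rmorphM /=; ring.
  rewrite -expiD mulrA -rmorphM /=; congr (_%:C%C * expi _); last first.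
    by rewrite /mu rmorphB mulrBl.
  rewrite (sample_weight_jacobian k p) /X /Y.
  move: (\prod_(_ < _) _) (\prod_(_ < _) _) (\prod_(_ < _) _) => g1 g2 g3.
  have : Num.sqrt (2 * pi) ^+ 2 = 2 * pi :> R by rewrite sqr_sqrtr// mulr_ge0// ltW.
  have : Num.sqrt (2 * pi) != 0 :> R by rewrite gt_eqF// sqrtr_gt0 mulr_gt0.
  move: (Num.sqrt _) => s s0 s2.
  transitivity (g1 * (pi / M%:R) * (g2 * g3) / s ^+ 2); first by field; rewrite s0.
  have pn : pi != 0 :> R by rewrite gt_eqF.
  rewrite s2 natrM; move: (M%:R : R) (pi : R) M0' pn => z q z0 q0.
  by field; rewrite z0 q0.
under eq_bigr do under eq_bigr do rewrite term.
under eq_bigr do rewrite -mulr_sumr -mulr_sumr.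
rewrite -mulr_suml -rmorph_sum /= sum_expi; last first.
  have := mcoord_le hd h (leqnn _); have := mcoord_le hd h' (leqnn _).
  rewrite /mu; move: (mcoord _ _ _) (mcoord _ _ _) => x y; lia.
case: eqP => [mu0|mu0]; last first.
  rewrite !mulr0; case: eqP => [el|//]; case: eqP => [em|//].
  by case: mu0; rewrite /mu el em subrr.
rewrite sum_node_factor//; last by apply/esym/eqP; rewrite -subr_eq0; apply/eqP.
have -> : (2 * M)%:R = ((2 * M)%:R : R)%:C%C :> R[i] by rewrite rmorph_nat.
rewrite -rmorphM mulVf ?rmorph1 ?mulr1 ?rmorph_nat//.
by rewrite pnatr_eq0 muln_eq0 negb_or -!lt0n.
Qed.

(** The coefficients [c] are arbitrary, so no integral over the sphere has to be evaluated: the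
    discrete scalar product with one harmonic selects its coefficient. Degrees l above [L0] are
    allowed for the reconstruction. *)
Lemma aliased_coef_band_limited (f : spoint R d -> R[i])
    (c : nat -> (d.-1).-tuple int -> R[i]) L0 l m :
  (forall x, sphere_coords R d x ->
    f x = \sum_(l' < L0.+1) \sum_(m' \in harm_index d l') c l' m' * hharm l' m' x) ->
  harm_index d l m -> (l + L0 < 2 * Q)%N -> (l + L0 < 2 * M)%N ->
  aliased_coef M t f l m = if (l <= L0)%N then c l m else 0.
Proof.
move=> fE h lQ lM.
have term k p : (sample_weight M t k)%:C%C * f (sample_point t k p)
    * ((hharm l m (sample_point t k p))^*)%C * (Defs.jacobian (sample_point t k p).1)%:C%C
  = \sum_(l' < L0.+1) \sum_(m' <- fset_set (harm_index d l')) c l' m' *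
    ((sample_weight M t k)%:C%C * hharm l' m' (sample_point t k p)
    * ((hharm l m (sample_point t k p))^*)%C * (Defs.jacobian (sample_point t k p).1)%:C%C).
  rewrite fE; last exact: sphere_coords_sample_point.
  rewrite mulr_sumr !mulr_suml; apply: eq_bigr => l' _.
  rewrite fsbig_finite; last exact: finite_harm_index.
  rewrite mulr_sumr !mulr_suml; apply: eq_bigr => m' _.
  ring.
rewrite /aliased_coef; under eq_bigr do under eq_bigr do rewrite term.
under eq_bigr do rewrite exchange_big /=.
rewrite exchange_big /=.
transitivity (\sum_(l' < L0.+1) \sum_(m' <- fset_set (harm_index d l'))
    c l' m' * ((l == l') && (m == m'))%:R).
  apply: eq_bigr => l' _.
  under eq_bigr do rewrite exchange_big /=.
  rewrite exchange_big /= big_seq [RHS]big_seq; apply: eq_bigr => m'.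
  rewrite in_fset_set; last exact: finite_harm_index.
  rewrite inE => h'; have := ltn_ord l' => l'L.
  rewrite -(discrete_orthonormal h h'); [|lia|lia].
  rewrite mulr_sumr; apply: eq_bigr => k _.
  by rewrite mulr_sumr.
have [lL|Ll] := leqP l L0; last first.
  rewrite big1// => l' _; rewrite big1// => m' _.
  by case: eqP => [el|]; rewrite ?mulr0//; have := ltn_ord l'; lia.
have lL1 : (l < L0.+1)%N by [].
rewrite (bigD1 (Ordinal lL1))//= [X in _ + X]big1 ?addr0; last first.
  move=> l' /eqP/val_eqP/= ll'; rewrite big1// => m' _.
  by rewrite eq_sym (negbTE ll') mulr0.
rewrite (bigD1_seq m) ?fset_uniq//=; last first.
  by rewrite in_fset_set ?inE//; exact: finite_harm_index.
rewrite !eqxx mulr1 big1 ?addr0// => m' mm'.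
by rewrite eq_sym (negbTE mm') mulr0.
Qed.

End DiscreteOrthonormality.

(** * Exact recovery of the coefficients and reconstruction of the field *)

Theorem theorem4 (R : realType) (d : nat) (hd : (2 <= d)%N)
    (disp : measure_display) (Om : measurableType disp) (P : probability Om R)
    (T : spoint R d -> Om -> R[i]) (L0 : nat)
    (hT : random_field T) (hband : band_limited T L0)
    (Q M : nat) (hQ : (L0 < Q)%N) (hM : (L0 < M)%N)
    (t : nat -> 'I_Q -> R) (ht : gegenbauer_nodes d t) :
  (forall (w : Om) (l : nat) (m : (d.-1).-tuple int),
     (l <= L0)%N -> harm_index d l m ->
     aliased_coef M t (T^~ w) l m = harm_coef (T^~ w) l m)
  /\
  (forall L : nat, (L0 <= L)%N -> (L <= Q)%N -> (L + L0 < 2 * M)%N ->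
   forall (w : Om) (x : spoint R d), sphere_coords R d x ->
     T x w =
     \sum_(k : {ffun 'I_d.-1 -> 'I_Q}) \sum_(p < 2 * M)
       ((\prod_(i < d.-1) colat_weight d t i.+1 (k i)) * azimuth_weight R M)%:C%C
       * (\prod_(i < d.-1) sin (node_colat t i.+1 (k i)) ^+ (d - i.+1))%:C%C
       * T (sample_point t k p) w
       * \sum_(l < L.+1) proj_kernel l x (sample_point t k p)).
Proof.
have M0 : (0 < M)%N by exact: leq_ltn_trans hM.
split => [w l m lL h|L L0L LQ LM w x xS].
  rewrite (aliased_coef_band_limited hd ht M0 (hband w) h) ?lL//; lia.
(* The expansion can run up to [L] because the aliased coefficients with L0 < l <= L vanish. There l
   + L0 < 2 Q follows from [LQ] and [hQ], and [LM] keeps differences of azimuthal orders below 2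
   M. *)
transitivity (\sum_(l < L.+1) \sum_(m <- fset_set (harm_index d l))
    aliased_coef M t (T^~ w) l m * hharm l m x).
  rewrite hband// (big_ord_widen L.+1 (fun l => \sum_(m \in harm_index d l)
    harm_coef (T^~ w) l m * hharm l m x))// big_mkcond/=.
  apply: eq_bigr => l _; have := ltn_ord l => lL.
  have fin := finite_harm_index hd l.
  case: ifP => lL0.
    rewrite fsbig_finite// big_seq [RHS]big_seq; apply: eq_bigr => m.
    rewrite in_fset_set// inE => h.
    rewrite (aliased_coef_band_limited hd ht M0 (hband w) h); [|lia|lia].
    by rewrite -ltnS lL0.
  rewrite big_seq big1// => m; rewrite in_fset_set// inE => h.
  rewrite (aliased_coef_band_limited hd ht M0 (hband w) h); [|lia|lia].
  by rewrite -ltnS lL0 mul0r.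
(* With the sums over the samples moved outside, the sums over l and m of products of harmonics at x
   and at a sample form the projector kernels. *)
rewrite /aliased_coef.
under eq_bigr do under eq_bigr do rewrite mulr_suml.
under eq_bigr do rewrite exchange_big /=.
rewrite exchange_big /=; apply: eq_bigr => k _.
under eq_bigr do under eq_bigr do rewrite mulr_suml.
under eq_bigr do rewrite exchange_big /=.
rewrite exchange_big /=; apply: eq_bigr => p _.
rewrite mulr_sumr; apply: eq_bigr => l _.
rewrite /proj_kernel fsbig_finite; last exact: finite_harm_index.
rewrite mulr_sumr; apply: eq_bigr => m _.
have -> : Defs.jacobian (sample_point t k p).1 =
    \prod_(i < d.-1) sin (node_colat t i.+1 (k i)) ^+ (d - i.+1).
  rewrite /Defs.jacobian big_add1 big_mkord; apply: eq_bigr => i _.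
  by rewrite (colat_sample_point t k p).
rewrite /sample_weight /=; ring.
Qed.
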